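(* For every real $b\neq\frac52$, the peakon $u(t,x)=\phi(x-t)$ of the $b$-Camassa--Holm equation $$u_t+uu_x+\tfrac14\phi'\ast\left[bu^2+(3-b)u_x^2\right]=0$$ is linearly unstable (in the sense defined in the context) in the class $$Y=C(\mathbb{R},\mathrm{Dom}(L))\cap C^1(\mathbb{R},L^2(\mathbb{R})).$$
   Context: $\phi(\xi)=e^{-|\xi|}$, $\phi'(\xi)=-\mathrm{sgn}(\xi)e^{-|\xi|}$ for $\xi\ne0$, $\ast$ is convolution on $\mathbb{R}$, $\langle\cdot,\cdot\rangle$ is the inner product of $L^2(\mathbb{R})$, $b\in\mathbb{R}$. Let $$Q(v)=\tfrac12(b-3)\,\phi\ast(\phi' v)-\tfrac12(2b-3)\,\phi'\ast(\phi v),\qquad L=(1-\phi)\partial_\xi+(2-b)\phi'+Q,$$ $$\mathrm{Dom}(L)=\{v\in L^2(\mathbb{R}):\ (1-\phi)v'\in L^2(\mathbb{R})\},$$ where the derivative is understood away from $\xi=0$ (weak derivative on $\mathbb{R}\setminus\{0\}$), and $\mathrm{Dom}(L)$ carries the graph norm. The linearized equation is $$\tilde v_t=L\tilde v-\tfrac32(b-2)\langle\phi\phi',\tilde v\rangle\phi.\qquad(\ast)$$ Definition: the peakon is linearly stable if for every $\tilde v_0\in\mathrm{Dom}(L)$ there exist a positive constant $C$ and a unique solution $\tilde v\in C(\mathbb{R},\mathrm{Dom}(L))$ of $(\ast)$ with $\tilde v(0,\xi)=\tilde v_0(\xi)$ such that $\|\tilde v(t,\cdot)\|_{L^2}\le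 C\|\tilde v_0\|_{L^2}$ for all $t>0$. Otherwise it is linearly unstable. *)

(* Defs.v *)
From mathcomp Require Import all_boot all_order all_algebra.
From mathcomp Require Import all_classical all_reals all_analysis.
Set Implicit Arguments.
Unset Strict Implicit.
Unset Printing Implicit Defensive.
Import Order.TTheory GRing.Theory Num.Theory.
Import numFieldNormedType.Exports.
Local Open Scope classical_set_scope.
Local Open Scope ring_scope.

(* L^2(R) is the space of real-valued functions in [Lfun leb 2%:E]; elements
   are represented by functions, so equality in L^2 is [%[ae leb]]. *)
Section Peakon.
Context {R : realType}.
Implicit Types (b t x : R) (f g h v w : R -> R) (U : set R) (V : R -> R -> R).

Definition leb : {measure set (measurableTypeR R) -> \bar R} := lebesgue_measure.

Definition L2 : set (R -> R) := [set f | f \in Lfun leb 2%:E].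

Definition L2norm f : \bar R := 'N[leb]_2%:E[EFin \o f]%E.

Definition inner f g : R := \int[leb]_x (f x * g x).

Definition convolution f g : R -> R := fun x => \int[leb]_y (f (x - y) * g y).

Definition phi : R -> R := fun x => expR (- `|x|).

Definition dphi : R -> R := fun x => - Num.sg x * expR (- `|x|).

Definition test_function U h : Prop :=
  [/\ forall n x, derivable (derive1n n h) x 1,
      compact (closure [set x | h x != 0]) &
      closure [set x | h x != 0] `<=` U].

Definition is_weak_derivative U f g : Prop :=
  [/\ locally_integrable U f, locally_integrable U g &
      forall h, test_function U h ->
        \int[leb]_(x in U) (f x * derive1 h x) = - \int[leb]_(x in U) (g x * h x)].

(* A weak derivative of [v] on R \ {0}, determined up to a null set; arbitrary
   if [v] has none. *)
Definition wderiv v : R -> R := get (is_weak_derivative (~` [set 0]) v).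

Definition Q b v : R -> R := fun x =>
  2^-1 * (b - 3) * convolution phi (fun y => dphi y * v y) x
  - 2^-1 * (2 * b - 3) * convolution dphi (fun y => phi y * v y) x.

Definition L b v : R -> R := fun x =>
  (1 - phi x) * wderiv v x + (2 - b) * dphi x * v x + Q b v x.

Definition DomL : set (R -> R) := [set v |
  [/\ L2 v, is_weak_derivative (~` [set 0]) v (wderiv v) &
      L2 (fun x => (1 - phi x) * wderiv v x)]].

Definition graph_norm b v : \bar R := (L2norm v + L2norm (L b v))%E.

Definition continuous_DomL b V : Prop :=
  (forall t, DomL (V t)) /\
  (forall t, graph_norm b (V s \- V t) @[s --> t] --> 0%E).

Definition continuous_L2 V : Prop :=
  (forall t, L2 (V t)) /\ (forall t, L2norm (V s \- V t) @[s --> t] --> 0%E).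

Definition is_L2_derivative V t w : Prop :=
  L2 w /\
  L2norm (fun x => e^-1 * (V (t + e) x - V t x) - w x) @[e --> 0^'] --> 0%E.

Definition C1_L2 V : Prop :=
  continuous_L2 V /\
  exists2 V' : R -> R -> R,
    (forall t, is_L2_derivative V t (V' t)) & continuous_L2 V'.

Definition classY b : set (R -> R -> R) :=
  [set V | continuous_DomL b V /\ C1_L2 V].

Definition linearized_rhs b v : R -> R := fun x =>
  L b v x - 3 / 2 * (b - 2) * inner (fun y => phi y * dphi y) v * phi x.

Definition is_solution b V v0 : Prop :=
  (forall t, is_L2_derivative V t (linearized_rhs b (V t))) /\
  V 0 = v0 %[ae leb].

Definition peakon_linearly_stable b (Y : set (R -> R -> R)) : Prop :=
  forall v0, DomL v0 ->
  exists2 C : R, 0 < C &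
  exists V : R -> R -> R,
    [/\ Y V, is_solution b V v0,
        forall W, Y W -> is_solution b W v0 -> forall t, W t = V t %[ae leb] &
        forall t, 0 < t -> (L2norm (V t) <= C%:E * L2norm v0)%E].

Definition peakon_linearly_unstable b (Y : set (R -> R -> R)) : Prop :=
  ~ peakon_linearly_stable b Y.

End Peakon.

(* Main.v *)
Require Import Defs.
From mathcomp Require Import all_boot all_order all_algebra.
From mathcomp Require Import all_classical all_reals all_analysis.
From mathcomp Require Import measurable_realfun ring lra.
Import Order.TTheory GRing.Theory Num.Theory.
Import numFieldNormedType.Exports.
Local Open Scope classical_set_scope.
Local Open Scope ring_scope.
Set Implicit Arguments.
Unset Strict Implicit.
Unset Printing Implicit Defensive.

(* The operator of the linearized equation has a real eigenfunction in Dom(L)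
   with a positive eigenvalue lam: e^xi on xi < 0 with lam = 2 - b if b < 2,
   e^-xi on xi > 0 with lam = b - 2 if b > 2, and a function supported on
   xi < 0 with an integrable singularity at 0 and lam = 1/4 if b = 2.  For an
   eigenfunction v, the curve e^(lam t) v is a solution in Y; if the peakon were
   stable it would be the bounded solution with initial value v, which is absurd.
   As [wderiv] chooses one weak derivative for each function, the computation of
   L (c v) rests on the a.e. uniqueness of weak derivatives, obtained by testing
   against smooth bumps that converge to indicators of intervals. *)

(** * Smooth bump functions *)

(** In the definition of stability the constant C may depend on the initial value. A genuine
    eigenfunction settles the matter directly, because its single orbit is already unbounded;
    approximate eigenfunctions would not do this. An eigenfunction supported on one half-line may
    jump or blow up at 0: test functions stay away from 0, and the factor 1 - phi, of order |xi|
    there, tames v'. This freedom is what makes such simple functions admissible. The reflection xi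
    -> -xi turns the operator of the equation into its negative, since derivation and [dphi] are
    odd. Hence the eigenvalue 2 - b of the exponential on the left becomes b - 2 on the right, and
    one of the two is positive unless b = 2. There both vanish, and a different eigenfunction has to
    be found. *)

Lemma powNexpR_le (R : realType) n (y : R) :
  0 <= y -> y ^+ n * expR (- y) <= n`!%:R.
Proof.
move=> y0; rewrite expRN ler_pdivrMr ?expR_gt0//.
case: n => [|n]; first by rewrite expr0 fact0 mul1r -expR0 ler_expR.
have := expR_ge1Dxn n y0; rewrite -ler_pdivrMl ?ltr0n ?fact_gt0//.
by rewrite mulrC; lra.
Qed.

(** * Differentiation rules for functions written pointwise *)

Section Pointwise_derivatives.
Context {R : realType}.
Implicit Types (f g : R -> R) (x : R).

Lemma is_derive1_eq f x (d d' : R) : is_derive x 1 f d -> d = d' ->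
  is_derive x 1 f d'.
Proof. by move=> ? <-. Qed.

Lemma is_derive1D f g x df dg : is_derive x 1 f df -> is_derive x 1 g dg ->
  is_derive x 1 (fun y => f y + g y) (df + dg).
Proof. by move=> hf hg; exact: is_deriveD. Qed.

Lemma is_derive1Z f (c : R) x df : is_derive x 1 f df ->
  is_derive x 1 (fun y => c * f y) (c * df).
Proof. by move=> hf; exact: is_deriveZ. Qed.

Lemma is_derive1N f x df : is_derive x 1 f df ->
  is_derive x 1 (fun y => - f y) (- df).
Proof. by move=> hf; exact: is_deriveN. Qed.

Lemma is_derive1M f g x df dg : is_derive x 1 f df -> is_derive x 1 g dg ->
  is_derive x 1 (fun y => f y * g y) (df * g x + f x * dg).
Proof.
move=> hf hg.
have -> : df * g x + f x * dg = f x * dg + g x * df by ring.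
exact: (is_deriveM hf hg).
Qed.

Lemma is_derive1X f n x df : is_derive x 1 f df ->
  is_derive x 1 (fun y => f y ^+ n) (n%:R * f x ^+ n.-1 * df).
Proof. by move=> hf; rewrite -exprfctE; exact: (is_deriveX n hf). Qed.

Lemma is_derive1V f x df : f x != 0 -> is_derive x 1 f df ->
  is_derive x 1 (fun y => (f y)^-1) (- (f x)^-1 ^+ 2 * df).
Proof. by move=> f0 hf; rewrite exprVn; exact: is_deriveV. Qed.

Lemma is_derive1_exp f x df : is_derive x 1 f df ->
  is_derive x 1 (fun y => expR (f y)) (expR (f x) * df).
Proof. by move=> hf; exact: (is_derive1_comp (is_derive_expR _)). Qed.

Lemma is_derive1_affine c a x : is_derive x 1 (fun y => c * (y - a)) c.
Proof.
apply: (is_derive1_eq (is_derive1Z c (is_derive1D (is_derive_id x 1)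
  (is_derive_cst (- a) x 1)))).
by rewrite addr0 mulr1.
Qed.

End Pointwise_derivatives.

Section Bump.
Context {R : realType}.
Implicit Types (a b c x : R).

(** The classical flat function e^(-1/x), extended by 0. The powers of 1/x are carried along because
    differentiation produces them: the derivative of [flat n] is a combination of [flat n.+2] and
    [flat n.+1]. *)
Definition flat n x : R := if 0 < x then x^-1 ^+ n * expR (- x^-1) else 0.

Lemma flat_near_neg n x : x < 0 -> \forall y \near x, 0 = flat n y.
Proof.
move=> x0; near=> y; rewrite /flat ltNge.
suff -> : y <= 0 by [].
by apply: ltW; near: y; exact: lt_nbhsl.
Unshelve. all: by end_near. Qed.

Lemma flat_near_pos n x : 0 < x ->
  \forall y \near x, y^-1 ^+ n * expR (- y^-1) = flat n y.
Proof.
move=> x0; near=> y; rewrite /flat.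
suff -> : 0 < y by [].
by near: y; exact: lt_nbhsr.
Unshelve. all: by end_near. Qed.

(** This is y^n e^(-y) <= n! at y = 1/x. Being uniform in x, it is the only estimate needed at the
    gluing point 0. *)
Lemma flat_le n x : `|flat n x| <= n`!%:R.
Proof.
rewrite /flat; case: ifPn => [x0|_]; last by rewrite normr0 ler0n.
have xV0 : 0 <= x^-1 by rewrite invr_ge0 ltW.
rewrite ger0_norm ?mulr_ge0 ?expR_ge0 ?exprn_ge0//.
exact: powNexpR_le.
Qed.

Lemma flatS n x : flat n x = x * flat n.+1 x.
Proof.
rewrite /flat; case: ifPn => [x0|_]; last by rewrite mulr0.
by rewrite exprS !mulrA mulfV ?mul1r// gt_eqF.
Qed.

Lemma flat0 n : flat n 0 = 0.
Proof. by rewrite /flat ltxx. Qed.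

Lemma is_derive_flat n x :
  is_derive x 1 (flat n) (flat n.+2 x - n%:R * flat n.+1 x).
Proof.
have [x0|x0|->] := ltgtP x 0.
- apply: (@near_eq_is_derive _ _ _ (cst 0)); first exact: flat_near_neg.
  by rewrite /flat !ltNge (ltW x0)/= mulr0 subr0; exact: is_derive_cst.
- apply: (@near_eq_is_derive _ _ _ (fun y : R => y^-1 ^+ n * expR (- y^-1))).
    exact: flat_near_pos.
  have dV := is_derive1V (lt0r_neq0 x0) (is_derive_id x 1).
  apply: (is_derive1_eq
    (is_derive1M (is_derive1X n dV) (is_derive1_exp (is_derive1N dV)))).
  rewrite /flat x0; case: n => [|n] /=.
    by rewrite !mul0r !exprS; ring.
  by rewrite !exprS; ring.
(* At 0 the slope function is [flat n.+1] by [flatS]. A second use of [flatS] writes it as z times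
   the bounded [flat n.+2], so it tends to 0. *)
- apply/is_derive1_caratheodory; exists (flat n.+1); split.
  + by move=> z; rewrite subr0 mulrC -flatS flat0 subr0.
  + suff fc : flat n.+1 z @[z --> (0 : R)] --> (0 : R).
      by rewrite /prop_for /continuous_at flat0.
    apply/cvgr0Pnorm_le => e e0.
    have f0 : (0 : R) < n.+2`!%:R by rewrite ltr0n fact_gt0.
    near=> z; rewrite flatS normrM.
    apply: (@le_trans _ _ (`|z| * n.+2`!%:R)).
      by rewrite ler_wpM2l// flat_le.
    rewrite -ler_pdivlMr//; near: z.
    exact: (@nbhs0_le _ R _ (divr_gt0 e0 f0)).
  + by rewrite !flat0 mulr0 subr0.
Unshelve. all: by end_near. Qed.


(* Closed under derivation, hence made of smooth functions. *)
Inductive bump_family (a b c : R) : (R -> R) -> Prop :=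
| bump_base k m n :
    bump_family a b c (fun x => k * (flat m (c * (x - a)) * flat n (c * (b - x))))
| bump_add f g : bump_family a b c f -> bump_family a b c g ->
    bump_family a b c (fun x => f x + g x).

Lemma bump_family_derive a b c f : bump_family a b c f ->
  exists2 g, bump_family a b c g & forall x, is_derive x 1 f (g x).
Proof.
elim=> {f} [k m n|f g _ [f' Ff' df] _ [g' Fg' dg]]; last first.
  exists (fun x => f' x + g' x); first exact: bump_add.
  by move=> x; exact: is_derive1D.
exists (fun x => (k * c) * (flat m.+2 (c * (x - a)) * flat n (c * (b - x)))
  + ((- (k * c * m%:R)) * (flat m.+1 (c * (x - a)) * flat n (c * (b - x)))
  + ((- (k * c)) * (flat m (c * (x - a)) * flat n.+2 (c * (b - x)))
  + (k * c * n%:R) * (flat m (c * (x - a)) * flat n.+1 (c * (b - x)))))).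
  by do 3 (apply: bump_add; first exact: bump_base); exact: bump_base.
move=> x.
have d1 : is_derive x 1 (fun y => c * (b - y)) (- c).
  rewrite (_ : (fun y => c * (b - y)) = (fun y => (- c) * (y - b))).
    exact: is_derive1_affine.
  by apply/funext => y; ring.
apply: (is_derive1_eq (is_derive1Z k (is_derive1M
  (is_derive1_comp (is_derive_flat m _) (is_derive1_affine c a x))
  (is_derive1_comp (is_derive_flat n _) d1)))).
by rewrite /=; ring.
Qed.

Lemma bump_family_smooth a b c f n x : bump_family a b c f ->
  derivable (derive1n n f) x 1.
Proof.
elim: n f => [|n IHn] f Ff; have [g Fg df] := bump_family_derive Ff.
  by rewrite /derive1n/=; exact: ex_derive.
rewrite derive1Sn (_ : derive1 f = g); first exact: IHn.
by apply/funext => y; rewrite derive1E; exact: derive_val.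
Qed.

(** The parameter c sharpens the bump without moving its support: as c grows, both factors tend to 1
    on ]a, b[, so the indicator of ]a, b[ is a bounded pointwise limit of test functions. *)
Definition smooth_bump a b c x := flat 0 (c * (x - a)) * flat 0 (c * (b - x)).

Lemma smooth_bump_out a b c x : 0 < c -> x \notin `]a, b[ ->
  smooth_bump a b c x = 0.
Proof.
move=> c0; rewrite in_itv/= /smooth_bump /flat !pmulr_rgt0// !subr_gt0.
by case: ifPn => //=; case: ifPn => //=; rewrite ?mulr0 ?mul0r.
Qed.

Lemma smooth_bump_test (U : set R) a b c : 0 < c -> `[a, b] `<=` U ->
  test_function U (smooth_bump a b c).
Proof.
move=> c0 abU.
have clab : closure [set x | smooth_bump a b c x != 0] `<=` `[a, b].
  have /closure_id -> : closed (`[a, b] : set R) by exact: itv_closed.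
  apply/closureS; move=> x /= /eqP hx.
  suff : x \in `]a, b[ by exact: subset_itv_oo_cc.
  by apply/negPn/negP => xab; exact: (hx (smooth_bump_out c0 xab)).
split.
- move=> n x; apply: (@bump_family_smooth a b c).
  rewrite (_ : smooth_bump a b c =
      fun x => 1 * (flat 0 (c * (x - a)) * flat 0 (c * (b - x)))).
    exact: bump_base.
  by apply/funext => y; rewrite mul1r.
- apply: subclosed_compact clab; first exact: closed_closure.
  exact: segment_compact.
- exact: subset_trans abU.
Qed.

Lemma smooth_bump_ge0_le1 a b c x : 0 <= smooth_bump a b c x <= 1.
Proof.
have H y : 0 <= flat 0 y <= 1.
  have := flat_le 0 y; rewrite ler_norml => /andP[_ ->]; rewrite andbT.
  by rewrite /flat; case: ifP => // _; rewrite mulr_ge0 ?expR_ge0// expr0.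
have /andP[? ?] := H (c * (x - a)); have /andP[? ?] := H (c * (b - x)).
by rewrite /smooth_bump mulr_ge0//= mulr_ile1.
Qed.

Lemma smooth_bump_cvg a b x : x \in `]a, b[ ->
  smooth_bump a b n.+1%:R x @[n --> \oo] --> (1 : R).
Proof.
rewrite in_itv/= => /andP[ax xb].
have H y : 0 < y -> flat 0 (n.+1%:R * y) @[n --> \oo] --> (1 : R).
  move=> y0.
  have -> : (fun n => flat 0 (n.+1%:R * y)) =
            (fun n => expR (- (n.+1%:R^-1 * y^-1))).
    by apply/funext => n; rewrite /flat pmulr_rgt0// y0 expr0 mul1r invfM.
  suff : expR (- (n.+1%:R^-1 * y^-1)) @[n --> \oo] --> expR (- (0 * y^-1)).
    by rewrite mul0r oppr0 expR0.
  apply: continuous_cvg; first exact: continuous_expR.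
  apply: cvgN; apply: cvgM; last exact: cvg_cst.
  exact: cvg_harmonic.
rewrite -subr_gt0 in ax; rewrite -subr_gt0 in xb.
suff : smooth_bump a b n.+1%:R x @[n --> \oo] --> (1 * 1 : R) by rewrite mulr1.
exact: (cvgM (H _ ax) (H _ xb)).
Qed.

End Bump.

(** * Weak derivatives *)

Section Weak_derivative_uniqueness.
Context {R : realType}.
Implicit Types (a b : R) (f g : R -> R) (U : set R).

#[global] Instance ae_filter_leb : Filter (nbhs (almost_everywhere (@leb R))).
Proof. exact: ae_filter_ringOfSetsType. Qed.

Lemma locally_integrable_itv U g a b : locally_integrable U g -> `[a, b] `<=` U ->
  leb.-integrable `[a, b] (EFin \o g).
Proof.
move=> [mg oU gK] abU; apply/integrableP; split.
  apply/measurable_EFinP; apply: measurable_funS mg => //.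
  exact: open_measurable.
exact/gK/segment_compact.
Qed.

Lemma derivable_continuous f x : derivable f x 1 -> {for x, continuous f}.
Proof. by move=> df; apply: differentiable_continuous; exact/derivable1_diffP. Qed.

(** Dominated convergence: the bumps lie between 0 and 1 and live on ]a, b[, so |g| dominates there
    and is integrable by local integrability. *)
Lemma smooth_bump_integral_cvg U g a b :
  locally_integrable U g -> `[a, b] `<=` U ->
  \int[leb]_(x in U) (g x * smooth_bump a b n.+1%:R x) @[n --> \oo] -->
  \int[leb]_(x in `]a, b[) g x.
Proof.
move=> lg abU.
have ig : leb.-integrable `]a, b[ (EFin \o g).
  apply: integrableS (locally_integrable_itv lg abU) => //.
  exact: subset_itv_oo_cc.
have mg := measurable_int _ ig.
have mbump n : measurable_fun (`]a, b[ : set R) (smooth_bump a b n.+1%:R).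
  apply: measurable_funTS; apply: continuous_measurable_fun => x.
  apply: derivable_continuous.
  have abab := @subset_refl _ (`[a, b] : set R).
  by have [/(_ 0%N x)] := smooth_bump_test (ltr0Sn R n) abab.
have E n : \int[leb]_(x in U) (g x * smooth_bump a b n.+1%:R x) =
    \int[leb]_(x in `]a, b[) (g x * smooth_bump a b n.+1%:R x).
  rewrite Rintegral_mkcond [RHS]Rintegral_mkcond; apply: eq_Rintegral => x _.
  rewrite !patchE; have [xab|xab] := boolP (x \in `]a, b[).
    rewrite !mem_set//; apply: abU; exact: subset_itv_oo_cc.
  rewrite [X in _ = if X then _ else _]memNset; last exact/negP.
  by rewrite smooth_bump_out// mulr0 if_same.
under eq_fun do rewrite E.
apply: fine_cvg; rewrite fineK; last exact: integrable_fin_num.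
have [] := @dominated_convergence _ _ _ leb `]a, b[%classic (measurable_itv _)
  (fun n x => (g x * smooth_bump a b n.+1%:R x)%:E) (EFin \o g) (fun x => `|g x|%:E).
- move=> n; apply/measurable_EFinP; apply: measurable_funM.
    exact/measurable_EFinP.
  exact: mbump.
- exact: mg.
- apply: aeW => x xab; apply: cvg_EFin; first exact: nearW.
  rewrite -[X in _ --> X]mulr1.
  by apply: cvgM; [exact: cvg_cst|exact: smooth_bump_cvg].
- exact: (integrable_abse ig).
- apply: aeW => x n xab; rewrite lee_fin normrM.
  have /andP[h0 h1] := smooth_bump_ge0_le1 a b n.+1%:R x.
  by rewrite ler_piMr// ger0_norm.
- by [].
Qed.

(** By Lebesgue's form of the fundamental theorem, g is a.e. the derivative of its primitive, and
    that primitive vanishes on ]a, b[. Extension by 0 makes the function integrable on the whole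
    line. *)
Lemma ae0_of_integral_itv g a b : leb.-integrable `[a, b] (EFin \o g) ->
  (forall y, a < y < b -> \int[leb]_(x in `]a, y[) g x = 0) ->
  {ae leb, forall x, a < x < b -> g x = 0}.
Proof.
move=> ig g0; pose f := g \_ `[a, b].
have iT : leb.-integrable setT (EFin \o f).
  by rewrite -restrict_EFin; apply/(integrable_restrict _ _ _ _).1; rewrite ?setTI.
have iD (D : set R) : measurable D -> leb.-integrable D (EFin \o f).
  by move=> mD; exact: integrableS iT.
have := @FTC1 R f (BRight a) (fun y => iD _ (measurable_itv _))
  (integrable_locally_restrict (measurable_itv _) ig).
apply: filterS => x /= H /andP[ax xb].
have [_] : _ /\ _ := H ax.
rewrite /f patchE mem_set/= ?in_itv/= ?(ltW ax) ?(ltW xb)// => <-.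
rewrite derive1E -[RHS](derive_cst (V := R) (W := R) 0 x 1).
apply: near_eq_derive; near=> y.
have ay : a < y by near: y; exact: lt_nbhsr.
have yb : y < b by near: y; exact: lt_nbhsl.
rewrite -Rintegral_itv_bndo_bndc; last exact: iD.
rewrite -[RHS](g0 y) ?ay ?yb//; apply: eq_Rintegral => z.
rewrite inE/= in_itv/= => /andP[az zy]; rewrite patchE mem_set//= in_itv/= (ltW az)/=.
exact/ltW/(lt_trans zy).
Unshelve. all: by end_near. Qed.

Lemma weak_derivative_unique f g1 g2 :
  is_weak_derivative (~` [set 0]) f g1 -> is_weak_derivative (~` [set 0]) f g2 ->
  g1 = g2 %[ae leb].
Proof.
move=> [_ lg1 h1] [_ lg2 h2].
have key a b : `[a, b] `<=` ~` [set 0 : R] ->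
    {ae leb, forall x, a < x < b -> g1 x - g2 x = 0}.
  move=> abU; apply: ae0_of_integral_itv.
    exact: locally_integrable_itv (locally_integrableB lg1 lg2) abU.
  move=> y /andP[ay yb].
  have ayU : `[a, y] `<=` ~` [set 0 : R].
    apply: subset_trans abU; apply: subset_itvl; rewrite bnd_simp; exact/ltW.
  have ii g : locally_integrable (~` [set 0 : R]) g ->
      leb.-integrable `]a, y[ (EFin \o g).
    move=> lg; apply: integrableS (locally_integrable_itv lg ayU) => //.
    exact: subset_itv_oo_cc.
  rewrite RintegralB//; [|exact: ii..].
  apply/eqP; rewrite subr_eq0; apply/eqP.
  have E n : \int[leb]_(x in ~` [set 0]) (g1 x * smooth_bump a y n.+1%:R x) =
      \int[leb]_(x in ~` [set 0]) (g2 x * smooth_bump a y n.+1%:R x).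
    apply: oppr_inj; have t := smooth_bump_test (ltr0Sn R n) ayU.
    by rewrite -(h1 _ t) -(h2 _ t).
  have := smooth_bump_integral_cvg lg1 ayU; under eq_fun do rewrite E.
  by move=> c1; exact: (cvg_unique _ c1 (smooth_bump_integral_cvg lg2 ayU)).
(* Countably many intervals, with closures avoiding 0, cover the complement of 0, so their
   exceptional null sets can be united. *)
have : {ae leb, forall x, forall n, (n.+1%:R^-1 < x < n.+1%:R -> g1 x - g2 x = 0) /\
    (- n.+1%:R < x < - n.+1%:R^-1 -> g1 x - g2 x = 0)}.
  apply: ae_foralln => n.
  apply: filterS2 (key n.+1%:R^-1 n.+1%:R _)
    (key (- n.+1%:R) (- n.+1%:R^-1) _) => //.
  - by move=> x /=; rewrite in_itv/= => /andP[+ _] x0; rewrite x0 leNgt invr_gt0 ltr0n.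
  - move=> x /=; rewrite in_itv/= => /andP[_ +] x0.
    by rewrite x0 oppr_ge0 leNgt invr_gt0 ltr0n.
have : {ae (@leb R), forall x : R, x != 0}.
  exists [set (0 : R)]; split => //; first exact: lebesgue_measure_set1.
  by move=> x /= /negP/negPn/eqP.
apply: filterS2 => x x0 H _; apply/eqP; rewrite -subr_eq0; apply/eqP.
have xgt0 : 0 < `|x| by rewrite normr_gt0.
near \oo => n.
have xn : `|x| < n.+1%:R.
  by rewrite (@lt_trans _ _ n%:R) ?ltr_nat//; near: n; exact: nbhs_infty_gtr.
have nx : n.+1%:R^-1 < `|x|.
  rewrite invf_plt ?posrE// (@lt_trans _ _ n%:R) ?ltr_nat//; near: n.
  exact: nbhs_infty_gtr.
have [x1|x1|x1] := ltgtP x 0.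
- by apply: (H n).2; rewrite ltr0_norm// in xn nx; rewrite ltrNl xn ltrNr.
- by apply: (H n).1; rewrite gtr0_norm// in xn nx; rewrite nx xn.
- by rewrite x1 eqxx in x0.
Unshelve. all: by end_near. Qed.

End Weak_derivative_uniqueness.

(** * Improper integrals *)

Section Improper_FTC.
Context {R : realType}.
Implicit Types (f F : R -> R) (D : set R) (a b c x y : R).

Lemma FTC_itv f F a b : a <= b ->
  (forall x, a <= x <= b -> is_derive x 1 F (f x)) ->
  (forall x, a <= x <= b -> {for x, continuous f}) ->
  (\int[leb]_(x in `[a, b]) (f x)%:E = (F b - F a)%:E)%E.
Proof.
rewrite le_eqVlt => /predU1P[<- _ _|ab dF cf].
  by rewrite subrr set_itv1 integral_set1.
have cF : {within `[a, b], continuous F}.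
  by apply: derivable_within_continuous => x; rewrite in_itv => /dF.
rewrite (@continuous_FTC2 _ f F)//.
- by apply: continuous_in_subspaceT => x; rewrite inE/= in_itv => /cf.
- have [_ Fa Fb] := (continuous_within_itvP F ab).1 cF; split => // x.
  by rewrite in_itv/= => /andP[/ltW ax /ltW xb]; have [] := dF x (introT andP (conj ax xb)).
- move=> x; rewrite in_itv/= => /andP[/ltW ax /ltW xb]; rewrite derive1E.
  by have [] := dF x (introT andP (conj ax xb)).
Qed.

Lemma Rintegral_FTC_itv f F a b : a <= b ->
  (forall x, a <= x <= b -> is_derive x 1 F (f x)) ->
  (forall x, a <= x <= b -> {for x, continuous f}) ->
  \int[leb]_(x in `[a, b]) f x = F b - F a.
Proof. by move=> ab dF cf; rewrite /Rintegral (FTC_itv ab dF cf). Qed.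

Section exhaustion.
(* [D] may be unbounded or not closed: [f] need not extend continuously to its
   closure. *)
Variables (f F : R -> R) (D : set R) (c d : nat -> R).
Hypothesis mD : measurable D.
Hypothesis cd : forall n, c n <= d n.
Hypothesis cdD : forall n, `[c n, d n] `<=` D.
Hypothesis Dcd : forall x, D x -> \forall n \near \oo, c n <= x <= d n.
Hypothesis dF : forall x, D x -> is_derive x 1 F (f x).
Hypothesis cf : forall x, D x -> {for x, continuous f}.

Let FTC_cd n : 
  (\int[leb]_(x in `[c n, d n]) (f x)%:E = (F (d n) - F (c n))%:E)%E.
Proof.
apply: FTC_itv => // x xcd; [apply: dF|apply: cf];
  by apply: (cdD (n:=n)); rewrite /= in_itv.
Qed.

Let patch_cvg x : D x -> (f \_ `[c n, d n]) x @[n --> \oo] --> f x.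
Proof.
move=> Dx; apply: cvg_near_cst.
by apply: filterS (Dcd Dx) => n xcd; rewrite patchE mem_set//= in_itv.
Qed.

Let integral_patch n :
  (\int[leb]_(x in D) ((f \_ `[c n, d n]) x)%:E = (F (d n) - F (c n))%:E)%E.
Proof.
rewrite -FTC_cd; transitivity (\int[leb]_(x in D) ((EFin \o f) \_ `[c n, d n]) x)%E.
  by rewrite restrict_EFin.
by rewrite -integral_mkcondr (setIidr (@cdD n)).
Qed.

Let measurable_patch n : measurable_fun D f ->
  measurable_fun D (EFin \o (f \_ `[c n, d n])).
Proof.
move=> mf; apply/measurable_EFinP/measurable_restrict => //.
by apply: measurable_funS mf => // x [].
Qed.

Variables (l m : R).
Hypothesis Fl : F (c n) @[n --> \oo] --> l.
Hypothesis Fm : F (d n) @[n --> \oo] --> m.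

Let integral_patch_cvg :
  (\int[leb]_(x in D) ((f \_ `[c n, d n]) x)%:E)%E @[n --> \oo] --> (m - l)%:E.
Proof.
under eq_fun do rewrite integral_patch.
by apply: cvg_EFin; [exact: nearW|exact: cvgB].
Qed.

Lemma ge0_integrable_exhaustion : measurable_fun D f ->
  (forall x, D x -> 0 <= f x) -> leb.-integrable D (EFin \o f).
Proof.
move=> mf f0; apply/integrableP; split; first exact/measurable_EFinP.
have fn0 n x : D x -> (0 <= (EFin \o (f \_ `[c n, d n])) x)%E.
  by move=> Dx; rewrite lee_fin/= patchE; case: ifP => // _; exact: f0.
have -> : (\int[leb]_(x in D) `|(EFin \o f) x| = \int[leb]_(x in D)
    limn_einf (fun n => (EFin \o (f \_ `[c n, d n])) x))%E.
  apply: eq_integral.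
  move=> x; rewrite inE => Dx /=; rewrite ger0_norm ?f0//.
  have /cvg_limn_einf_sup[-> _]// : ((f \_ `[c n, d n]) x)%:E @[n --> \oo] --> (f x)%:E.
  by apply: cvg_EFin; [exact: nearW|exact: patch_cvg].
(* Fatou: the integrals over the exhausting intervals are [F (d n) - F (c n)], whose limit m - l is
   finite. *)
apply: le_lt_trans (fatou leb mD (fun n => measurable_patch n mf) fn0) _.
have [-> _] := cvg_limn_einf_sup integral_patch_cvg.
by rewrite ltry.
Qed.

(** Here f may change sign: with integrability given, |f| dominates its restrictions and replaces
    the argument by Fatou. *)
Lemma Rintegral_exhaustion : leb.-integrable D (EFin \o f) ->
  \int[leb]_(x in D) f x = m - l.
Proof.
move=> fi; have mf : measurable_fun D f.
  by apply/measurable_EFinP; exact: measurable_int fi.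
have [] := @dominated_convergence _ _ _ leb D mD
  (fun n => EFin \o (f \_ `[c n, d n])) (EFin \o f) (fun x => `|f x|%:E).
- by move=> n; exact: measurable_patch.
- exact/measurable_EFinP.
- apply: aeW => x xab; apply: cvg_EFin; first exact: nearW.
  exact: patch_cvg.
- exact: (integrable_abse fi).
- apply: aeW => x n Dx; rewrite lee_fin patchE; case: ifP => // _.
  by rewrite normr0.
by move=> _ _ H; rewrite /Rintegral (cvg_unique _ H integral_patch_cvg).
Qed.

End exhaustion.

End Improper_FTC.

(** * Classical derivatives away from 0 are weak derivatives *)

Section Classical_weak_derivative.
Context {R : realType}.
Implicit Types (v w h : R -> R).

Lemma open_neq0 : open (~` [set (0 : R)]).
Proof. by rewrite openC; exact: closed_eq. Qed.

Lemma continuous_locally_integrable (U : set R) v : open U ->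
  (forall x, U x -> {for x, continuous v}) -> locally_integrable U v.
Proof.
move=> oU cv; split => //.
  by apply: open_continuous_measurable_fun => // x; rewrite inE => /cv.
move=> K KU cK.
have /integrableP[_] : leb.-integrable K (EFin \o v); last by [].
apply: continuous_compact_integrable => //.
by apply: continuous_in_subspaceT => x; rewrite inE => /KU /cv.
Qed.

(** Whatever v does at 0, a test function h vanishes near 0, because its compact support avoids 0.
    So v h is continuously differentiable on all of R, and integrating its derivative over [-N, N]
    is the integration by parts. *)
Lemma classical_weak_derivative v w :
  (forall x : R, x != 0 -> is_derive x 1 v (w x)) ->
  (forall x : R, x != 0 -> {for x, continuous w}) ->
  is_weak_derivative (~` [set 0]) v w.
Proof.
move=> dv cw.
have cv (x : R) : x != 0 -> {for x, continuous v}.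
  by move=> x0; apply: derivable_continuous; have [] := dv _ x0.
split.
- by apply: continuous_locally_integrable; [exact: open_neq0|move=> x /eqP/cv].
- by apply: continuous_locally_integrable; [exact: open_neq0|move=> x /eqP/cw].
move=> h th; have [hd cS SU] := th.
have dh (x : R) : is_derive x 1 h (derive1 h x).
  by rewrite derive1E; apply: derivableP; exact: (hd 0%N).
have ch (x : R) : {for x, continuous h} by apply: derivable_continuous; exact: (hd 0%N).
have ch' (x : R) : {for x, continuous (derive1 h)}.
  by apply: derivable_continuous; exact: (hd 1%N).
have h0 : \forall y \near (0 : R), h y = 0.
  have : nbhs (0 : R) (~` closure [set x | h x != 0]).
    apply: open_nbhs_nbhs; split; first by rewrite openC; exact: closed_closure.
    by move=> /SU; apply.
  apply: filterS => y hy; apply/eqP/negPn/negP => hy0; apply: hy.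
  exact: subset_closure.
have h'0 : \forall y \near (0 : R), derive1 h y = 0.
  move: h0 => /nbhs_interior; apply: filterS => y hy.
  rewrite derive1E -[RHS](derive_cst (V := R) (W := R) 0 y 1).
  exact: near_eq_derive.
have [N N0 hN] : exists2 N : R, 0 < N & forall y, N <= `|y| -> h y = 0.
  have [M [_ hM]] := compact_bounded cS.
  (* [hM] bounds the support by any number above M, such as |M| + 1; the further 1 puts every y with
     |y| >= N strictly outside. *)
  exists (`|M| + 2) => [|y Ny]; first by rewrite ltr_wpDl.
  apply/eqP/negPn/negP => hy.
  have : `|y| <= `|M| + 1.
    apply: (hM (`|M| + 1)); last exact: subset_closure.
    by rewrite (le_lt_trans (ler_norm M))// ltrDl.
  by apply/negP; rewrite -ltNge (lt_le_trans _ Ny)// ltrD2l ltr1n.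
(* The inequality is strict so that h vanishes on a whole neighbourhood of y. *)
have h'N (y : R) : N < `|y| -> derive1 h y = 0.
  move=> Ny; rewrite derive1E -[RHS](derive_cst (V := R) (W := R) 0 y 1).
  apply: near_eq_derive; near=> z; apply/hN/ltW; near: z.
  by apply: (cvgr_norm_gt y) => //; exact: cvg_id.
have near0_cont (f : R -> R) : (\forall y \near (0 : R), f y = 0) ->
    (forall x : R, x != 0 -> {for x, continuous f}) -> forall x, {for x, continuous f}.
  move=> f0 cf x; have [->|/cf//] := eqVneq x 0.
  rewrite /prop_for /continuous_at (nbhs_singleton f0).
  exact: cvg_near_cst.
have cvh' := near0_cont (fun x => v x * derive1 h x).
have cwh := near0_cont (fun x => w x * h x).
have {}cvh' (x : R) : {for x, continuous (fun x => v x * derive1 h x)}.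
  apply: cvh'; first by apply: filterS h'0 => y ->; rewrite mulr0.
  by move=> y y0; apply: continuousM; [exact: cv|exact: ch'].
have {}cwh (x : R) : {for x, continuous (fun x => w x * h x)}.
  apply: cwh; first by apply: filterS h0 => y ->; rewrite mulr0.
  by move=> y y0; apply: continuousM; [exact: cw|exact: ch].
(* Since f vanishes at 0 and beyond N, restoring the point 0 and cutting at N leave its integral
   unchanged. *)
have int_eq (f : R -> R) : (forall x, {for x, continuous f}) -> f 0 = 0 ->
    (forall x, N < `|x| -> f x = 0) ->
    leb.-integrable `[- N, N] (EFin \o f) /\
    \int[leb]_(x in ~` [set 0]) f x = \int[leb]_(x in `[- N, N]) f x.
  move=> cf f0 fN; split.
    apply: continuous_compact_integrable; first exact: segment_compact.
    by apply: continuous_in_subspaceT => x _; exact: cf.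
  rewrite Rintegral_mkcond [RHS]Rintegral_mkcond; apply: eq_Rintegral => x _.
  rewrite !patchE; have [->|x0] := eqVneq x 0; first by rewrite f0 !if_same.
  rewrite mem_set/=; last exact/eqP.
  case: ifPn => // xN; apply: fN; rewrite ltNge; apply/negP => xN'.
  move/negP: xN; apply; rewrite inE/= in_itv/=; by rewrite -ler_norml.
have [|x xN|i1 ->] := int_eq _ cvh'.
- by rewrite (nbhs_singleton h'0) mulr0.
- by rewrite h'N// mulr0.
have [|x xN|i2 ->] := int_eq _ cwh.
- by rewrite (nbhs_singleton h0) mulr0.
- by rewrite hN ?mulr0// ltW.
apply/eqP; rewrite -addr_eq0 -RintegralD//; apply/eqP.
have -> : \int[leb]_(x in `[- N, N]) (v x * derive1 h x + w x * h x) =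
    v N * h N - v (- N) * h (- N).
  apply: (@Rintegral_FTC_itv _ _ (fun x => v x * h x)).
  - by rewrite ge0_cp// ltW.
  - move=> x _; have [->|x0] := eqVneq x 0; last first.
      by apply: (is_derive1_eq (is_derive1M (dv x x0) (dh x))); ring.
    rewrite (nbhs_singleton h0) (nbhs_singleton h'0) !mulr0 addr0.
    apply: (@near_eq_is_derive _ _ _ (cst 0)).
    by apply: filterS h0 => y ->; rewrite mulr0.
  - by move=> x _; apply: continuousD; [exact: cvh'|exact: cwh].
by rewrite !hN ?normrN ?ger0_norm ?(ltW N0)// !mulr0 subrr.
Unshelve. all: by end_near. Qed.

End Classical_weak_derivative.

(** * Exponentials on half-lines and functions glued at 0 *)

Section Half_lines.
Context {R : realType}.
Implicit Types (f g F : R -> R) (a x y : R).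

Lemma cvg_expR_affine a x : 0 < a -> expR (a * (x - n%:R)) @[n --> \oo] --> (0 : R).
Proof.
move=> a0.
have ay : a * (n%:R - x) @[n --> \oo] --> +oo.
  apply/cvgryPge => A; near=> n.
  rewrite -ler_pdivrMl// lerBrDr; near: n; exact: nbhs_infty_ger.
rewrite (_ : (fun n => _) = fun n => expR (- (a * (n%:R - x)))).
  exact: (cvg_comp _ _ ay (@cvgr_expR R)).
by apply/funext => n; congr expR; ring.
Unshelve. all: by end_near. Qed.

Lemma is_derive_expM a x : is_derive x 1 (fun y => expR (a * y)) (a * expR (a * x)).
Proof.
apply: (is_derive1_eq (is_derive1_exp (is_derive1Z a (is_derive_id x 1)))).
by rewrite mulr1 mulrC.
Qed.

Lemma continuous_expM a : continuous (fun y : R => expR (a * y)).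
Proof. by move=> x; apply: derivable_continuous; have [] := is_derive_expM a x. Qed.

Let exhaust_left x y : y <= x -> \forall n \near \oo, x - n%:R <= y <= x.
Proof.
move=> yx; near=> n; rewrite yx andbT lerBlDr -lerBlDl; near: n.
exact: nbhs_infty_ger.
Unshelve. all: by end_near. Qed.

Let exhaust_right x y : x <= y -> \forall n \near \oo, x <= y <= x + n%:R.
Proof.
move=> xy; near=> n; rewrite xy -lerBlDl; near: n.
exact: nbhs_infty_ger.
Unshelve. all: by end_near. Qed.

Lemma exp_itvNyc a x : 0 < a ->
  leb.-integrable `]-oo, x] (EFin \o (fun y => expR (a * y))) /\
  \int[leb]_(y in `]-oo, x]) expR (a * y) = a^-1 * expR (a * x).
Proof.
move=> a0.
have dF y : is_derive y 1 (fun y => a^-1 * expR (a * y)) (expR (a * y)).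
  apply: (is_derive1_eq (is_derive1Z a^-1 (is_derive_expM a y))).
  by rewrite mulrA mulVf ?mul1r// gt_eqF.
have cdD n : `[x - n%:R, x] `<=` `]-oo, x].
  by move=> y /=; rewrite !in_itv/= => /andP[].
have Fl : a^-1 * expR (a * (x - n%:R)) @[n --> \oo] --> (0 : R).
  by rewrite -(mulr0 a^-1); apply: cvgM; [exact: cvg_cst|exact: cvg_expR_affine].
have cd n : x - n%:R <= x by rewrite lerBlDr lerDl.
have Dcd y : `]-oo, x]%classic y -> \forall n \near \oo, x - n%:R <= y <= x.
  by rewrite /= in_itv/= => /exhaust_left.
have fi : leb.-integrable `]-oo, x] (EFin \o (fun y => expR (a * y))).
  apply: (ge0_integrable_exhaustion _ cd cdD Dcd (fun y _ => dF y)
    (fun y _ => @continuous_expM a y) Fl (cvg_cst _)) => //.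
  apply: measurable_funTS; apply: continuous_measurable_fun.
  exact: continuous_expM.
split => //; rewrite (Rintegral_exhaustion _ cd cdD Dcd (fun y _ => dF y)
    (fun y _ => @continuous_expM a y) Fl (cvg_cst _))//.
by rewrite subr0.
Qed.

Lemma exp_itvcy a x : 0 < a ->
  leb.-integrable `[x, +oo[ (EFin \o (fun y => expR (- a * y))) /\
  \int[leb]_(y in `[x, +oo[) expR (- a * y) = a^-1 * expR (- a * x).
Proof.
move=> a0.
have dF y : is_derive y 1 (fun y => - a^-1 * expR (- a * y)) (expR (- a * y)).
  apply: (is_derive1_eq (is_derive1Z (- a^-1) (is_derive_expM (- a) y))).
  by rewrite mulrA mulrNN mulVf ?mul1r// gt_eqF.
have cdD n : `[x, x + n%:R] `<=` `[x, +oo[.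
  by move=> y /=; rewrite !in_itv/= => /andP[->].
have Fl : - a^-1 * expR (- a * (x + n%:R)) @[n --> \oo] --> (0 : R).
  rewrite -(mulr0 (- a^-1)); apply: cvgM; first exact: cvg_cst.
  have := @cvg_expR_affine a (- x) a0.
  by under eq_fun do rewrite -opprD mulrN -mulNr.
have cd n : x <= x + n%:R by rewrite lerDl.
have Dcd y : `[x, +oo[%classic y -> \forall n \near \oo, x <= y <= x + n%:R.
  by rewrite /= in_itv/= andbT => /exhaust_right.
have fi : leb.-integrable `[x, +oo[ (EFin \o (fun y => expR (- a * y))).
  apply: (ge0_integrable_exhaustion _ cd cdD Dcd (fun y _ => dF y)
    (fun y _ => @continuous_expM (- a) y) (cvg_cst _) Fl) => //.
  apply: measurable_funTS; apply: continuous_measurable_fun.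
  exact: continuous_expM.
split => //; rewrite (Rintegral_exhaustion _ cd cdD Dcd (fun y _ => dF y)
    (fun y _ => @continuous_expM (- a) y) (cvg_cst _) Fl)//.
by rewrite sub0r mulNr opprK.
Qed.

Lemma exp_itvoy a x : 0 < a ->
  leb.-integrable `]x, +oo[ (EFin \o (fun y => expR (- a * y))) /\
  \int[leb]_(y in `]x, +oo[) expR (- a * y) = a^-1 * expR (- a * x).
Proof.
move=> a0; have [fi fE] := exp_itvcy x a0.
have fi' : leb.-integrable `]x, +oo[ (EFin \o (fun y => expR (- a * y))).
  by apply: integrableS fi => //; apply: subset_itvr; rewrite bnd_simp.
by split => //; rewrite Rintegral_itv_obnd_cbnd.
Qed.

Lemma setT_itv x : setT = `]-oo, x] `|` `]x, +oo[ :> set R.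
Proof.
apply/esym/seteqP; split => // y _ /=; rewrite !in_itv/= andbT.
by case: leP; [left|right].
Qed.

Lemma integrable_setT_itv f x : leb.-integrable `]-oo, x] (EFin \o f) ->
  leb.-integrable `]x, +oo[ (EFin \o f) -> leb.-integrable setT (EFin \o f).
Proof.
move=> /integrableP[m1 i1] /integrableP[m2 i2]; rewrite (setT_itv x).
have m12 : measurable_fun (`]-oo, x] `|` `]x, +oo[) (EFin \o f).
  by apply/measurable_funU.
apply/integrableP; split => //; rewrite ge0_integral_setU//=.
- by rewrite lte_add_pinfty.
- by apply/measurable_EFinP; apply: measurableT_comp => //; exact/measurable_EFinP.
- apply/disj_setPS => y [] /=; rewrite !in_itv/= andbT => yx.
  by rewrite ltNge yx.
Qed.

Lemma Rintegral_setT_itv f x : leb.-integrable setT (EFin \o f) ->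
  \int[leb]_y f y = \int[leb]_(y in `]-oo, x]) f y + \int[leb]_(y in `]x, +oo[) f y.
Proof.
move=> fi; rewrite (setT_itv x) Rintegral_setU//; first by rewrite -setT_itv.
apply/disj_setPS => y [] /=; rewrite !in_itv/= andbT => yx.
by rewrite ltNge yx.
Qed.

(** No matching at 0 is asked for: the derivatives and continuity below are claimed only off 0, so a
    jump or a singularity is allowed. *)
Definition piecewise f g x := if x < 0 then f x else g x.

Lemma near_piecewise_neg f g x : x < 0 -> \forall y \near x, f y = piecewise f g y.
Proof.
move=> x0; near=> y; rewrite /piecewise; suff -> : y < 0 by [].
by near: y; exact: lt_nbhsl.
Unshelve. all: by end_near. Qed.

Lemma near_piecewise_pos f g x : 0 < x -> \forall y \near x, g y = piecewise f g y.
Proof.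
move=> x0; near=> y; rewrite /piecewise ltNge; suff -> : 0 <= y by [].
by apply: ltW; near: y; exact: lt_nbhsr.
Unshelve. all: by end_near. Qed.

Lemma is_derive_piecewise f g df dg x :
  (forall x : R, x < 0 -> is_derive x 1 f (df x)) ->
  (forall x : R, 0 < x -> is_derive x 1 g (dg x)) ->
  x != 0 -> is_derive x 1 (piecewise f g) (piecewise df dg x).
Proof.
move=> hf hg; have [x0 _|x0 _|->] := ltgtP x 0; last by [].
- rewrite /(piecewise df) x0; have := hf _ x0.
  by apply: near_eq_is_derive; exact: near_piecewise_neg.
- rewrite /(piecewise df) ltNge (ltW x0); have := hg _ x0.
  by apply: near_eq_is_derive; exact: near_piecewise_pos.
Qed.

Lemma continuous_piecewise f g x :
  (forall x, x < 0 -> {for x, continuous f}) ->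
  (forall x, 0 < x -> {for x, continuous g}) ->
  x != 0 -> {for x, continuous (piecewise f g)}.
Proof.
move=> hf hg; have [x0 _|x0 _|->] := ltgtP x 0; last by [].
- rewrite /prop_for /continuous_at {2}/piecewise x0.
  apply: cvg_trans (hf _ x0); apply: near_eq_cvg; exact: near_piecewise_neg.
- rewrite /prop_for /continuous_at {2}/piecewise ltNge (ltW x0).
  apply: cvg_trans (hg _ x0); apply: near_eq_cvg; exact: near_piecewise_pos.
Qed.

End Half_lines.

(** * Square-integrable functions and the peakon *)

Section L2_facts.
Context {R : realType}.
Implicit Types (f g v w : R -> R) (c x : R).

Lemma L2P f : L2 f <->
  measurable_fun setT f /\ leb.-integrable setT (EFin \o (fun x => f x ^+ 2)).
Proof.
split=> [Lf|[mf fi]].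
  split; last exact: Lfun2_integrable_sqr.
  by move: Lf; rewrite /L2/= inE => /andP[]; rewrite inE.
rewrite /L2/= inE; apply/andP; split; rewrite inE//=.
rewrite /finite_norm unlock poweR_lty//.
have /integrableP[_] := fi; apply: le_lt_trans.
under eq_integral do rewrite /= powR_mulrn// -normrX.
by [].
Qed.

Lemma L2_measurable f : L2 f -> measurable_fun setT f.
Proof. by move=> /L2P[]. Qed.

Lemma L2norm_fin f : L2 f -> L2norm f \is a fin_num.
Proof.
rewrite /L2/= inE => /andP[_]; rewrite inE/= /finite_norm => h.
by rewrite ge0_fin_numE// Lnorm_ge0.
Qed.

Lemma L2_le f g C : L2 f -> measurable_fun setT g ->
  (forall x, `|g x| <= C * `|f x|) -> L2 g.
Proof.
move=> /L2P[mf fi] mg gf; apply/L2P; split => //.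
apply: (@le_integrable _ _ _ leb _ _ _ (fun x => (C ^+ 2 * f x ^+ 2)%:E)) => //.
- by apply/measurable_EFinP; exact: measurable_funX.
- move=> x _; rewrite lee_fin/= -exprMn !normrX ler_pXn2r ?nnegrE// normrM.
  by apply: le_trans (gf x) _; rewrite ler_wpM2r// ler_norm.
- exact: (integrableZl measurableT (C ^+ 2) fi).
Qed.

Lemma L2norm_ae f g : measurable_fun setT f -> measurable_fun setT g ->
  f = g %[ae leb] -> L2norm f = L2norm g.
Proof.
have mpow (h : R -> R) : measurable_fun setT h ->
    measurable_fun setT (fun x => (`|(EFin \o h) x| `^ 2)%E).
  move=> mh; apply/measurable_EFinP.
  apply: (@measurableT_comp _ _ _ _ _ _ (@powR R ^~ 2)) => //.
  exact: measurableT_comp.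
move=> mf mg fg; rewrite /L2norm unlock; congr (_ `^ _)%E.
apply: ae_eq_integral => //; [exact: mpow|exact: mpow|].
by apply: filterS fg => x /[apply] /= ->.
Qed.

Lemma L2_ae f g : L2 f -> measurable_fun setT g -> f = g %[ae leb] -> L2 g.
Proof.
move=> Lf mg fg; rewrite /L2/= inE; apply/andP; split; rewrite inE//= /finite_norm.
rewrite -[X in (X < _)%E]/(L2norm g) -(L2norm_ae (L2_measurable Lf) mg fg).
by have := L2norm_fin Lf; rewrite ge0_fin_numE// Lnorm_ge0.
Qed.

Lemma L2Z f c : L2 f -> L2 (fun x => c * f x).
Proof.
move=> Lf; apply: (@L2_le _ _ `|c| Lf) => [|x]; last by rewrite normrM.
by apply: measurable_funM => //; exact: L2_measurable.
Qed.

Lemma L2D f g : L2 f -> L2 g -> L2 (fun x => f x + g x).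
Proof. by move=> Lf Lg; exact: ((Lfun_addr_closed leb (lee1n 2)).2 f g Lf Lg). Qed.

Lemma L2normZ f c : L2 f -> L2norm (fun x => c * f x) = (`|c|%:E * L2norm f)%E.
Proof.
by move=> Lf; exact: (LnormZ (Lfun_Sub (lee1n 2) Lf) c).
Qed.

Lemma L2_integrableM f g : L2 f -> L2 g ->
  leb.-integrable setT (EFin \o (fun x => f x * g x)).
Proof. by move=> Lf Lg; apply/Lfun1_integrable; exact: Lfun2_mul_Lfun1. Qed.

Lemma measurable_fun_neq0 f : measurable_fun (~` [set 0] : set R) f ->
  measurable_fun setT f.
Proof.
move=> mf; rewrite -(setvU [set (0 : R)]); apply/measurable_funU => //.
  exact: measurableC.
by split => //; exact: measurable_fun_set1.
Qed.

Lemma ae_neq0 (P : R -> Prop) : (forall x, x != 0 -> P x) -> {ae leb, forall x, P x}.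
Proof.
move=> Pn0; exists [set (0 : R)]; split => //; first exact: lebesgue_measure_set1.
by move=> x /= Px; apply: contrapT => /eqP x0; exact/Px/Pn0.
Qed.

Lemma measurable_continuous_neq0 v : (forall x, x != 0 -> {for x, continuous v}) ->
  measurable_fun setT v.
Proof.
move=> cv; apply: measurable_fun_neq0.
apply: open_continuous_measurable_fun; first exact: open_neq0.
by move=> x; rewrite inE => /eqP; exact: cv.
Qed.

Lemma L2norm_neq0 v a b : L2 v -> a < b -> (forall x, a < x < b -> v x != 0) ->
  L2norm v != 0%E.
Proof.
move=> Lv ab vn0; apply/eqP => /Lnorm_eq0_eq0.
have mv : measurable_fun setT (EFin \o v).
  by apply/measurable_EFinP; exact: L2_measurable.
move=> /(_ mv (ltr0Sn _ _)) [N [mN N0 vN]].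
have : (leb `]a, b[%classic <= leb N)%E.
  apply: le_measure; rewrite ?inE//.
  move=> x /=; rewrite in_itv/= => /vn0 vx; apply: vN => /= /(_ I) [].
  by apply/eqP.
have E : leb `]a, b[%classic = (b - a)%:E.
  by rewrite -[LHS]/(lebesgue_measure `]a, b[%classic) lebesgue_measure_itv/=
    lte_fin ab.
by rewrite N0 E lee_fin leNgt subr_gt0 ab.
Qed.

End L2_facts.

(** * The peakon profile and the nonlocal operators *)

Section Phi.
Context {R : realType}.
Implicit Types (v : R -> R) (b c x : R).

Lemma continuous_phi : continuous (@phi R).
Proof.
move=> x; apply: continuous_comp; last exact: continuous_expR.
by apply: continuousN; exact: norm_continuous.
Qed.

Lemma measurable_phi : measurable_fun setT (@phi R).
Proof. exact: continuous_measurable_fun continuous_phi. Qed.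

Lemma phi_ge0 x : 0 <= phi x. Proof. exact: expR_ge0. Qed.

Lemma phi_le1 x : phi x <= 1.
Proof. by rewrite /phi -expR0 ler_expR oppr_le0. Qed.

Lemma dphiE x : dphi x = - Num.sg x * phi x. Proof. by []. Qed.

Lemma phi_neg x : x <= 0 -> phi x = expR x.
Proof. by move=> x0; rewrite /phi ler0_norm ?opprK. Qed.

Lemma phi_pos x : 0 <= x -> phi x = expR (- x).
Proof. by move=> x0; rewrite /phi ger0_norm. Qed.

Lemma dphi_neg x : x < 0 -> dphi x = expR x.
Proof. by move=> x0; rewrite dphiE ltr0_sg// opprK mul1r phi_neg// ltW. Qed.

Lemma dphi_pos x : 0 < x -> dphi x = - expR (- x).
Proof. by move=> x0; rewrite dphiE gtr0_sg// mulN1r phi_pos// ltW. Qed.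

Lemma measurable_dphi : measurable_fun setT (@dphi R).
Proof.
apply: measurable_fun_neq0.
apply: (eq_measurable_fun (piecewise phi (fun y => - phi y))).
  move=> x; rewrite inE /= /piecewise => /eqP; case: ltgtP => // x0 _.
    by rewrite dphi_neg// phi_neg// ltW.
  by rewrite dphi_pos// phi_pos// ltW.
apply: open_continuous_measurable_fun; first exact: open_neq0.
move=> x; rewrite inE => /eqP; apply: continuous_piecewise => y _.
  exact: continuous_phi.
by apply: continuousN; exact: continuous_phi.
Qed.

Lemma dphi_le x : `|dphi x| <= phi x.
Proof.
rewrite dphiE normrM normrN (ger0_norm (phi_ge0 x)) ler_piMl ?phi_ge0//.
by rewrite normr_sg; case: (x != 0).
Qed.

Lemma L2_phi : L2 (@phi R).
Proof.
apply/L2P; split; first exact: measurable_phi.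
apply: (@integrable_setT_itv _ _ 0).
  have [] := @exp_itvNyc R 2 0 (ltr0Sn _ _); move=> /eq_integrable + _; apply => //.
  move=> y; rewrite inE/= in_itv/= => y0.
  by rewrite phi_neg// expr2 -expRD; congr (expR _)%:E; ring.
have [] := @exp_itvoy R 2 0 (ltr0Sn _ _); move=> /eq_integrable + _; apply => //.
move=> y; rewrite inE/= in_itv/= andbT => y0.
by rewrite phi_pos ?ltW// expr2 -expRD; congr (expR _)%:E; ring.
Qed.

Lemma L2_phi_shift x : L2 (fun y => phi (x - y)).
Proof.
(* The triangle inequality |y| <= |x| + |x - y| gives phi (x - y) <= e^|x| phi y. *)
apply: (@L2_le _ _ _ (expR `|x|) L2_phi).
  apply: (measurableT_comp measurable_phi); exact: measurable_funB.
move=> y; rewrite (ger0_norm (phi_ge0 (x - y))) (ger0_norm (phi_ge0 y)).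
rewrite /phi -expRD ler_expR.
by have := lerB_dist y x; rewrite distrC; lra.
Qed.

Lemma L2_dphi_shift x : L2 (fun y => dphi (x - y)).
Proof.
apply: (@L2_le _ _ _ 1 (L2_phi_shift x)).
  apply: (measurableT_comp measurable_dphi); exact: measurable_funB.
by move=> y; rewrite mul1r (ger0_norm (phi_ge0 _)) dphi_le.
Qed.

Lemma L2_phiM v : L2 v -> L2 (fun y => phi y * v y).
Proof.
move=> Lv; apply: (@L2_le _ _ _ 1 Lv).
  by apply: measurable_funM; [exact: measurable_phi|exact: L2_measurable].
by move=> y; rewrite normrM ler_wpM2r// (ger0_norm (phi_ge0 _)) phi_le1.
Qed.

Lemma L2_dphiM v : L2 v -> L2 (fun y => dphi y * v y).
Proof.
move=> Lv; apply: (@L2_le _ _ _ 1 Lv).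
  by apply: measurable_funM; [exact: measurable_dphi|exact: L2_measurable].
by move=> y; rewrite normrM ler_wpM2r// (le_trans (dphi_le _))// phi_le1.
Qed.

(** In contrast to [wderiv], which scales only a.e., the convolutions are honest integrals of
    products of two L^2 functions, so they scale at every point. *)
Lemma Q_Z b c v x : L2 v -> Q b (fun y => c * v y) x = c * Q b v x.
Proof.
move=> Lv; rewrite /Q /convolution.
have E f g : L2 f -> L2 (fun y => g y * v y) ->
    \int[leb]_y (f y * (g y * (c * v y))) = c * \int[leb]_y (f y * (g y * v y)).
  move=> Lf Lg; rewrite -RintegralZl//; last exact: L2_integrableM.
  by apply: eq_Rintegral => y _; ring.
rewrite (E (fun y => phi (x - y)) dphi (L2_phi_shift x) (L2_dphiM Lv)).
rewrite (E (fun y => dphi (x - y)) phi (L2_dphi_shift x) (L2_phiM Lv)).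
by ring.
Qed.

Lemma inner_Z c g v : L2 g -> L2 v -> inner g (fun y => c * v y) = c * inner g v.
Proof.
move=> Lg Lv; rewrite /inner -RintegralZl//; last exact: L2_integrableM.
by apply: eq_Rintegral => y _; ring.
Qed.

End Phi.

(** * Eigenfunctions and instability *)

Section Eigenfunction_instability.
Context {R : realType}.
Variables (b lam : R) (v w : R -> R).
Implicit Types (c s t x : R).
Hypothesis lam_gt0 : 0 < lam.
Hypothesis Lv : L2 v.
Hypothesis v_neq0 : L2norm v != 0%E.
Hypothesis dv : forall x : R, x != 0 -> is_derive x 1 v (w x).
Hypothesis cw : forall x : R, x != 0 -> {for x, continuous w}.
Hypothesis Lw : L2 (fun x => (1 - phi x) * w x).
Let inn := inner (fun y => phi y * dphi y) v.
Hypothesis eigen : forall x, x != 0 ->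
  (1 - phi x) * w x + (2 - b) * dphi x * v x + Q b v x
  - 3 / 2 * (b - 2) * inn * phi x = lam * v x.

Let weak_derivZ c :
  is_weak_derivative (~` [set 0]) (fun x => c * v x) (fun x => c * w x).
Proof.
apply: classical_weak_derivative => x x0; first exact: is_derive1Z (dv x0).
by apply: continuousM; [exact: cvg_cst|exact: cw].
Qed.

Let wd c := wderiv (fun x => c * v x).

Let wd_weak c : is_weak_derivative (~` [set 0]) (fun x => c * v x) (wd c).
Proof. exact: getPex (ex_intro _ _ (weak_derivZ c)). Qed.

Let wd_ae c : (fun x => c * w x) = wd c %[ae leb].
Proof. exact: weak_derivative_unique (weak_derivZ c) (wd_weak c). Qed.

Let m_wd c : measurable_fun setT (wd c).
Proof. by have [_ [mw _ _] _] := wd_weak c; exact: measurable_fun_neq0. Qed.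

Let mv : measurable_fun setT v. Proof. exact: L2_measurable. Qed.

Let mw : measurable_fun setT w.
Proof.
have [_ [mw _ _] _] := weak_derivZ 1.
apply: measurable_fun_neq0; apply: eq_measurable_fun mw => x _ /=.
by rewrite mul1r.
Qed.

(** Measurability of the convolutions is read off from the eigenvalue equation, which expresses
    [Q b v] off 0 by functions known to be measurable. *)
Let mQ : measurable_fun setT (Q b v).
Proof.
apply: measurable_fun_neq0; apply: (eq_measurable_fun (fun x => lam * v x
  - (1 - phi x) * w x - (2 - b) * dphi x * v x + 3 / 2 * (b - 2) * inn * phi x)).
  by move=> x; rewrite inE => /eqP x0; rewrite -(eigen x0); ring.
apply: measurable_funTS; have mphi := @measurable_phi R; have mdphi := @measurable_dphi R.
repeat (apply: measurable_funB || apply: measurable_funD || apply: measurable_funM) => //.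
Qed.

(** What the eigenvalue equation says L v is. It is visibly in L^2 and scales exactly, so it
    replaces [L b v], which depends on the chosen weak derivative. *)
Let Lgen x := lam * v x + 3 / 2 * (b - 2) * inn * phi x.

Let L_Lgen : L2 Lgen.
Proof. by apply: L2D; apply: L2Z => //; exact: L2_phi. Qed.

Let L_ae c : (fun x => c * Lgen x) = L b (fun x => c * v x) %[ae leb].
Proof.
have H : {ae leb, forall x, c * Lgen x = (1 - phi x) * (c * w x) +
    (2 - b) * dphi x * (c * v x) + Q b (fun x => c * v x) x}.
  by apply: ae_neq0 => x x0; rewrite /Lgen -(eigen x0) Q_Z//; ring.
apply: filterS2 (wd_ae c) H => x /(_ I) Ewd E _; rewrite E.
by rewrite /L -[wderiv _ x]/(wd c x) -Ewd.
Qed.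

Let mL c : measurable_fun setT (L b (fun x => c * v x)).
Proof.
have mphi := @measurable_phi R; have mdphi := @measurable_dphi R.
have -> : L b (fun x => c * v x) = fun x => (1 - phi x) * wd c x +
    (2 - b) * dphi x * (c * v x) + c * Q b v x.
  by apply/funext => x; rewrite /L Q_Z.
have mwd := m_wd c.
repeat (apply: measurable_funB || apply: measurable_funD || apply: measurable_funM) => //.
Qed.

Let rhs_ae c : (fun x => c * lam * v x) = linearized_rhs b (fun x => c * v x) %[ae leb].
Proof.
apply: filterS (L_ae c) => x /(_ I) E _.
rewrite /linearized_rhs -E inner_Z//; first by rewrite -/inn /Lgen; ring.
by apply: L2_phiM; apply: (@L2_le _ _ _ 1 L2_phi) => [|y];
  [exact: measurable_dphi|rewrite mul1r (ger0_norm (phi_ge0 y)) dphi_le].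
Qed.

Let m_rhs c : measurable_fun setT (linearized_rhs b (fun x => c * v x)).
Proof.
have mphi := @measurable_phi R; have := mL c => mLc.
by apply: measurable_funB => //; apply: measurable_funM.
Qed.

Let W t x := expR (lam * t) * v x.

Let WB s t : W s \- W t = (fun x => (expR (lam * s) - expR (lam * t)) * v x).
Proof. by apply/funext => x; rewrite /W /= mulrBl. Qed.

Let DomLZ c : DomL (fun x => c * v x).
Proof.
split; [exact: L2Z|exact: wd_weak|].
apply: (L2_ae (L2Z c Lw)).
  have mphi := @measurable_phi R; have := m_wd c => mwd.
  by apply: measurable_funM => //; apply: measurable_funB.
by apply: filterS (wd_ae c) => x /(_ I) E _; rewrite -[wderiv _ x]/(wd c x) -E; ring.
Qed.

(** On the line spanned by v the graph norm is |c| times a finite constant. The continuity of the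
    curve in Dom(L) thus reduces to that of the scalar e^(lam t). *)
Let graph_normZ c : graph_norm b (fun x => c * v x) =
  (`|c|%:E * (L2norm v + L2norm Lgen))%E.
Proof.
rewrite /graph_norm -(L2norm_ae _ (mL c) (L_ae c)); last first.
  by apply: L2_measurable; exact: L2Z.
rewrite !L2normZ// muleDr//.
by rewrite fin_num_adde_defl// L2norm_fin.
Qed.

Let cvg_coef (K : \bar R) (k : R -> R) (F : set_system R) : Filter F ->
  K \is a fin_num -> k s @[s --> F] --> (0 : R) -> 
  (`|k s|%:E * K)%E @[s --> F] --> 0%E.
Proof.
move=> FF Kfin k0; rewrite -(fineK Kfin).
under eq_fun do rewrite -EFinM.
apply: cvg_EFin; first exact: nearW.
by rewrite -(mul0r (fine K)) -(normr0 R); apply: cvgM; [exact: cvg_norm|exact: cvg_cst].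
Qed.

Let cvg_expB t : expR (lam * s) - expR (lam * t) @[s --> t] --> (0 : R).
Proof.
rewrite -(subrr (expR (lam * t))); apply: cvgB; last exact: cvg_cst.
exact: (@continuous_expM _ lam t).
Qed.

Let W_DomL : continuous_DomL b W.
Proof.
split=> t; first exact: DomLZ.
under eq_fun do rewrite WB graph_normZ.
apply: cvg_coef; last exact: cvg_expB.
by rewrite fin_numD !L2norm_fin.
Qed.

Let W_L2 : continuous_L2 W.
Proof.
split=> t; first exact: L2Z.
under eq_fun do rewrite WB L2normZ//.
by apply: cvg_coef; [exact: L2norm_fin|exact: cvg_expB].
Qed.

(** Any measurable representative u is allowed, so that the lemma serves twice: for the explicit
    derivative in the C^1 condition and for [linearized_rhs], equal to it only a.e. *)
Let W_deriv t u : measurable_fun setT u ->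
  (fun x => expR (lam * t) * lam * v x) = u %[ae leb] -> is_L2_derivative W t u.
Proof.
move=> mu Eu; split; first exact: L2_ae (L2Z _ Lv) mu Eu.
pose k e := e^-1 * (expR (lam * (t + e)) - expR (lam * t)) - expR (lam * t) * lam.
have E e : L2norm (fun x => e^-1 * (W (t + e) x - W t x) - u x) =
    (`|k e|%:E * L2norm v)%E.
  rewrite -L2normZ//; apply: L2norm_ae.
  - repeat (apply: measurable_funB || apply: measurable_funD || apply: measurable_funM) => //.
  - by apply: measurable_funM.
  - by apply: filterS Eu => x /(_ I) <- _; rewrite /k /W; ring.
under eq_fun do rewrite E.
apply: cvg_coef; first exact: L2norm_fin.
have [hd hv] := is_derive_expM lam t.
suff H : e^-1 * (expR (lam * (t + e)) - expR (lam * t)) @[e --> 0^'] -->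
    expR (lam * t) * lam.
  rewrite -[X in _ --> X](subrr (expR (lam * t) * lam)).
  exact: cvgB H (cvg_cst _).
rewrite [X in _ --> X]mulrC -hv.
suff -> : (fun e => e^-1 * (expR (lam * (t + e)) - expR (lam * t))) =
    (fun h : R => h^-1 *: (((fun y => expR (lam * y)) \o shift t) (h *: (1 : R))
    - expR (lam * t))) by exact: hd.
apply/funext => e.
rewrite -[RHS]/(e^-1 * (expR (lam * (e * 1 + t)) - expR (lam * t))).
by rewrite mulr1 [e + t]addrC.
Qed.

Let W_classY : classY b W.
Proof.
split; first exact: W_DomL.
split; first exact: W_L2.
exists (fun t x => expR (lam * t) * lam * v x).
  move=> t; apply: W_deriv; last exact: (@aeW _ _ _ leb).
  by apply: L2_measurable; exact: L2Z.
split=> t; first exact: L2Z.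
have E s : (fun x => expR (lam * s) * lam * v x) \- (fun x => expR (lam * t) * lam * v x)
    = fun x => (lam * (expR (lam * s) - expR (lam * t))) * v x.
  by apply/funext => x /=; ring.
under eq_fun do rewrite E L2normZ//.
apply: cvg_coef; first exact: L2norm_fin.
by rewrite -[X in _ --> X](mulr0 lam); apply: cvgM; [exact: cvg_cst|exact: cvg_expB].
Qed.

Let W_solution : is_solution b W v.
Proof.
split=> [t|]; first by apply: W_deriv; [exact: m_rhs|exact: rhs_ae].
by apply: aeW => x _; rewrite /W mulr0 expR0 mul1r.
Qed.

Lemma unstable_of_eigenfunction : peakon_linearly_unstable b (classY b).
Proof.
move=> stable.
have v1 : (fun x => 1 * v x) = v by apply/funext => x; rewrite mul1r.
have Dv : DomL v by have := DomLZ 1; rewrite v1.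
have [C C0 [V [[[VD _] _] _ uniq bound]]] := stable v Dv.
(* At time C / lam the orbit has grown by the factor e^C >= 1 + C, which exceeds the supposed bound
   C. *)
have t0 : 0 < C / lam by exact: divr_gt0.
have [LV _ _] := VD (C / lam).
have := bound _ t0.
rewrite -(L2norm_ae _ _ (uniq W W_classY W_solution _)); last 2 first.
- by apply: L2_measurable; exact: L2Z.
- exact: L2_measurable.
rewrite L2normZ// -(fineK (L2norm_fin Lv)) -!EFinM lee_fin ger0_norm ?expR_ge0//.
have N0 : 0 < fine (L2norm v).
  by rewrite fine_gt0// lt0e v_neq0 Lnorm_ge0/= -ge0_fin_numE ?Lnorm_ge0// L2norm_fin.
rewrite ler_pM2r// mulrCA mulfV ?mulr1 ?gt_eqF//.
by have := expR_ge1Dx C; lra.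
Qed.

End Eigenfunction_instability.

(** * Explicit eigenfunctions *)

Section Kernel.
Context {R : realType}.
Implicit Types (f g F v : R -> R) (a b p q x y : R).

Lemma Rintegral_FTC_oo f F a b : a <= b ->
  (forall x, a <= x <= b -> is_derive x 1 F (f x)) ->
  (forall x, a <= x <= b -> {for x, continuous f}) ->
  \int[leb]_(x in `]a, b[) f x = F b - F a.
Proof.
move=> ab dF cf; rewrite -(Rintegral_FTC_itv ab dF cf).
have fi : leb.-integrable `[a, b] (EFin \o f).
  apply: continuous_compact_integrable; first exact: segment_compact.
  by apply: continuous_in_subspaceT => x; rewrite inE/= in_itv => /cf.
rewrite Rintegral_itv_bndo_bndc; last first.
  by apply: integrableS fi => //; exact: subset_itv_oo_cc.
rewrite Rintegral_itv_obnd_cbnd//.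
by apply: integrableS fi => //; exact: subset_itv_oc_cc.
Qed.

Lemma Rintegral_setT_split2 f p q : p < q -> leb.-integrable setT (EFin \o f) ->
  \int[leb]_y f y = \int[leb]_(y in `]-oo, p[) f y +
    \int[leb]_(y in `]p, q[) f y + \int[leb]_(y in `]q, +oo[) f y.
Proof.
move=> pq fi.
have iD (D : set R) : measurable D -> leb.-integrable D (EFin \o f).
  by move=> mD; exact: integrableS fi.
rewrite (Rintegral_setT_itv q fi); congr (_ + _).
rewrite [X in _ = X + _]Rintegral_itv_bndo_bndc; last exact: iD.
rewrite [X in _ = _ + X]Rintegral_itv_bndo_bndc; last exact: iD.
rewrite -(@Rintegral_itvB _ f -oo%O (BRight q) p); first by rewrite addrC subrK.
- exact: iD.
- by [].
- by rewrite bnd_simp ltW.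
Qed.

(* The kernel of [Q] together with the rank-one term of the linearized equation.
   It vanishes when [x] and [y] have opposite signs, so functions supported on
   one half-line form an invariant subspace. *)
Definition kernel b x y : R :=
  2^-1 * (b - 3) * (phi (x - y) * dphi y) - 2^-1 * (2 * b - 3) * (dphi (x - y) * phi y)
  - 3 / 2 * (b - 2) * phi x * (phi y * dphi y).

(** Merging the three integrals makes the cancellations between [Q] and the rank-one term pointwise
    identities of [kernel]. *)
Lemma kernel_integral b v x : L2 v ->
  leb.-integrable setT (EFin \o (fun y => kernel b x y * v y)) /\
  Q b v x - 3 / 2 * (b - 2) * inner (fun y => phi y * dphi y) v * phi x =
  \int[leb]_y (kernel b x y * v y).
Proof.
move=> Lv.
have i1 := L2_integrableM (L2_phi_shift x) (L2_dphiM Lv).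
have i2 := L2_integrableM (L2_dphi_shift x) (L2_phiM Lv).
have i3 := L2_integrableM L2_phi (L2_dphiM Lv).
have iZ c f : leb.-integrable setT (EFin \o f) ->
    leb.-integrable setT (EFin \o (fun y => c * f y)).
  by move=> fi; exact: (integrableZl measurableT c fi).
have iB (f g : R -> R) : leb.-integrable setT (EFin \o f) ->
    leb.-integrable setT (EFin \o g) ->
    leb.-integrable setT (EFin \o (fun y => f y - g y)).
  by move=> fi gi; apply: eq_integrable (integrableB measurableT fi gi).
have j1 := iZ (2^-1 * (b - 3)) _ i1.
have j2 := iZ (2^-1 * (2 * b - 3)) _ i2.
have j3 := iZ (3 / 2 * (b - 2) * phi x) _ i3.
have j12 := iB _ _ j1 j2.
have E y : kernel b x y * v y = 2^-1 * (b - 3) * (phi (x - y) * (dphi y * v y))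
    - 2^-1 * (2 * b - 3) * (dphi (x - y) * (phi y * v y))
    - 3 / 2 * (b - 2) * phi x * (phi y * (dphi y * v y)).
  by rewrite /kernel; ring.
rewrite (_ : (fun y => kernel b x y * v y) = fun y =>
    2^-1 * (b - 3) * (phi (x - y) * (dphi y * v y))
    - 2^-1 * (2 * b - 3) * (dphi (x - y) * (phi y * v y))
    - 3 / 2 * (b - 2) * phi x * (phi y * (dphi y * v y))); last exact/funext.
split; first exact: iB j12 j3.
rewrite RintegralB// RintegralB// !RintegralZl//.
rewrite /Q /convolution /inner; congr (_ - _).
rewrite -mulrA [_ * phi x]mulrC mulrA; congr (_ * _).
by apply: eq_Rintegral => y _; rewrite mulrA.
Qed.

(** The reflection symmetry of the equation; it yields the formulas on the right half-line from
    those on the left. *)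
Lemma kernelNN b x y : kernel b (- x) (- y) = - kernel b x y.
Proof.
have phiN z : phi (- z) = phi z by rewrite /phi normrN.
have dphiN z : dphi (- z) = - dphi z by rewrite !dphiE phiN sgrN !mulNr.
rewrite /kernel -[- x - - y]opprD !phiN !dphiN; ring.
Qed.

Lemma expR_double y : expR (2 * y) = expR y * expR y.
Proof. by rewrite -expRD; congr expR; ring. Qed.

(** All three terms are multiples of e^(2y - x), and (b - 3)/2 + (2b - 3)/2 = 3(b - 2)/2: the
    rank-one term exactly cancels what [Q] carries across 0. *)
Lemma kernel_neg_pos b x y : y < 0 -> 0 < x -> kernel b x y = 0.
Proof.
move=> y0 x0; have xy : 0 < x - y by lra.
rewrite /kernel (phi_pos (ltW xy)) (dphi_pos xy) (phi_neg (ltW y0)) (dphi_neg y0).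
by rewrite (phi_pos (ltW x0)) opprB expRD; field.
Qed.

Lemma kernel_neg_lt b x y : y < x -> x < 0 ->
  kernel b x y = 3 / 2 * (b - 2) * (expR (- x) - expR x) * expR (2 * y).
Proof.
move=> yx x0; have xy : 0 < x - y by lra.
have y0 : y < 0 by lra.
rewrite /kernel (phi_pos (ltW xy)) (dphi_pos xy) (phi_neg (ltW y0)) (dphi_neg y0).
by rewrite (phi_neg (ltW x0)) opprB expRD expR_double; field.
Qed.

Lemma kernel_neg_gt b x y : x < y -> y < 0 -> kernel b x y =
  - (b / 2 * expR x + 3 / 2 * (b - 2) * expR x * expR (2 * y)).
Proof.
move=> xy y0; have xy0 : x - y < 0 by lra.
have x0 : x < 0 by lra.
rewrite /kernel (phi_neg (ltW xy0)) (dphi_neg xy0) (phi_neg (ltW y0)) (dphi_neg y0).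
rewrite (phi_neg (ltW x0)) expRD expRN expR_double; field.
exact/lt0r_neq0/expR_gt0.
Qed.

Lemma kernel_pos_neg b x y : 0 < y -> x < 0 -> kernel b x y = 0.
Proof.
move=> y0 x0; rewrite -[kernel _ _ _]opprK -kernelNN kernel_neg_pos ?oppr0//.
  by rewrite oppr_lt0.
by rewrite oppr_gt0.
Qed.

Lemma kernel_pos_gt b x y : x < y -> 0 < x ->
  kernel b x y = 3 / 2 * (b - 2) * (expR (- x) - expR x) * expR (- 2 * y).
Proof.
move=> yx x0; rewrite -[kernel _ _ _]opprK -kernelNN kernel_neg_lt ?ltrN2//.
  by rewrite mulrN -mulNr opprK; ring.
by rewrite oppr_lt0.
Qed.

Lemma kernel_pos_lt b x y : y < x -> 0 < y -> kernel b x y =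
  b / 2 * expR (- x) + 3 / 2 * (b - 2) * expR (- x) * expR (- 2 * y).
Proof.
move=> xy y0; rewrite -[kernel _ _ _]opprK -kernelNN kernel_neg_gt ?ltrN2//.
  by rewrite mulrN -mulNr opprK.
by rewrite oppr_lt0.
Qed.

Lemma kernel_integral0 b v x : (forall y, kernel b x y * v y = 0) ->
  \int[leb]_y (kernel b x y * v y) = 0.
Proof.
move=> kv0; rewrite (_ : (fun y => kernel b x y * v y) = cst 0); last exact/funext.
by rewrite Rintegral_cst// mul0r.
Qed.

Lemma kernel_left_pos b v x : (forall y, 0 <= y -> v y = 0) -> 0 < x ->
  \int[leb]_y (kernel b x y * v y) = 0.
Proof.
move=> v0 x0; apply: kernel_integral0 => y.
by have [y0|/v0 ->] := ltP y 0; rewrite ?mulr0// kernel_neg_pos// mul0r.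
Qed.

Lemma kernel_right_neg b v x : (forall y, y <= 0 -> v y = 0) -> x < 0 ->
  \int[leb]_y (kernel b x y * v y) = 0.
Proof.
move=> v0 x0; apply: kernel_integral0 => y.
by have [/v0 ->|y0] := leP y 0; rewrite ?mulr0// kernel_pos_neg// mul0r.
Qed.

Lemma kernel_left_neg b v x : L2 v -> (forall y, 0 <= y -> v y = 0) -> x < 0 ->
  \int[leb]_y (kernel b x y * v y) =
  \int[leb]_(y in `]-oo, x[)
    (3 / 2 * (b - 2) * (expR (- x) - expR x) * expR (2 * y) * v y) +
  \int[leb]_(y in `]x, 0[)
    (- (b / 2 * expR x + 3 / 2 * (b - 2) * expR x * expR (2 * y)) * v y).
Proof.
move=> Lv v0 x0; have [ki _] := kernel_integral b x Lv.
rewrite (Rintegral_setT_split2 x0 ki).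
rewrite [X in _ + X](_ : _ = 0) ?addr0; last first.
  rewrite (@eq_Rintegral _ _ _ _ _ (cst 0)) ?Rintegral_cst ?mul0r// => y.
  by rewrite inE/= in_itv/= andbT => /ltW/v0 ->; rewrite mulr0.
congr (_ + _); apply: eq_Rintegral => y; rewrite inE/= in_itv/=.
  by move=> yx; rewrite kernel_neg_lt.
by move=> /andP[xy y0]; rewrite kernel_neg_gt.
Qed.

Lemma kernel_right_pos b v x : L2 v -> (forall y, y <= 0 -> v y = 0) -> 0 < x ->
  \int[leb]_y (kernel b x y * v y) =
  \int[leb]_(y in `]0, x[)
    ((b / 2 * expR (- x) + 3 / 2 * (b - 2) * expR (- x) * expR (- 2 * y)) * v y) +
  \int[leb]_(y in `]x, +oo[)
    (3 / 2 * (b - 2) * (expR (- x) - expR x) * expR (- 2 * y) * v y).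
Proof.
move=> Lv v0 x0; have [ki _] := kernel_integral b x Lv.
rewrite (Rintegral_setT_split2 x0 ki).
rewrite [X in X + _ + _](_ : _ = 0) ?add0r; last first.
  rewrite (@eq_Rintegral _ _ _ _ _ (cst 0)) ?Rintegral_cst ?mul0r// => y.
  by rewrite inE/= in_itv/= => /ltW/v0 ->; rewrite mulr0.
congr (_ + _); apply: eq_Rintegral => y; rewrite inE/= in_itv/=.
  by move=> /andP[y0 yx]; rewrite kernel_pos_lt.
by rewrite andbT => xy; rewrite kernel_pos_gt.
Qed.

End Kernel.

(** * Exponential eigenfunctions for b < 2 and for b > 2 *)

Section Exponential_eigenfunctions.
Context {R : realType}.
Implicit Types (v : R -> R) (a b x y : R).

Let expL := piecewise (@expR R) (cst 0).
Let expLE x : x < 0 -> expL x = expR x.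
Proof. by rewrite /expL /piecewise => ->. Qed.
Let expL0 x : 0 <= x -> expL x = 0.
Proof. by rewrite /expL /piecewise ltNge => ->. Qed.

Let d_expL x : x != 0 -> is_derive x 1 expL (expL x).
Proof. exact: is_derive_piecewise. Qed.

Let c_expL x : x != 0 -> {for x, continuous expL}.
Proof. by move=> x0; apply: derivable_continuous; have [] := d_expL x0. Qed.

Let L_expL : L2 expL.
Proof.
apply: (@L2_le _ _ _ 1 L2_phi); first exact: measurable_continuous_neq0.
move=> x; rewrite mul1r (ger0_norm (phi_ge0 x)); have [x0|x0] := ltP x 0.
  by rewrite expLE// ger0_norm ?expR_ge0// phi_neg// ltW.
by rewrite expL0// normr0 phi_ge0.
Qed.

Let L_expLw : L2 (fun x => (1 - phi x) * expL x).
Proof.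
have mL := L2_measurable L_expL; have mphi := @measurable_phi R.
apply: (@L2_le _ _ _ 1 L_expL).
  by apply: measurable_funM => //; apply: measurable_funB.
move=> x; rewrite normrM ler_wpM2r// ger0_norm ?subr_ge0 ?phi_le1//.
by rewrite gerBl phi_ge0.
Qed.

(** The e^(4x) terms from both sides of x cancel. Added to the local part (1 - e^x) e^x + (2 - b)
    e^(2x), the result also cancels every e^(2x), and (2 - b) e^x remains. *)
Let left_Q b x : x < 0 -> \int[leb]_y (kernel b x y * expL y) =
  (b - 1) * (expR x * expR x - expR x).
Proof.
move=> x0; rewrite (kernel_left_neg _ _ expL0)//.
have [i3 E3] := @exp_itvNyc R 3 x (ltr0Sn _ _).
have i3' : leb.-integrable `]-oo, x[ (EFin \o (fun y => expR (3 * y))).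
  by apply: integrableS i3 => //; apply: subset_itvl; rewrite bnd_simp.
set c := 3 / 2 * (b - 2).
rewrite [X in X + _](_ : _ =
    c * (expR (- x) - expR x) * (3^-1 * expR (3 * x))); last first.
  rewrite -E3 -Rintegral_itv_bndo_bndc// -RintegralZl//; apply: eq_Rintegral => y.
  rewrite inE/= in_itv/= => yx.
  by rewrite expLE ?(lt_trans yx)// -mulrA -expRD; congr (_ * expR _); ring.
rewrite [X in _ + X](_ : _ =
    (- (b / 2 * expR x) * expR 0 + - (c * expR x) * (3^-1 * expR (3 * 0))) -
    (- (b / 2 * expR x) * expR x + - (c * expR x) * (3^-1 * expR (3 * x)))); last first.
  transitivity (\int[leb]_(y in `]x, 0[)
      (- (b / 2 * expR x) * expR y + - (c * expR x) * expR (3 * y))).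
    apply: eq_Rintegral => y; rewrite inE/= in_itv/= => /andP[_ y0].
    by rewrite expLE// (_ : 3 * y = 2 * y + y) ?expRD; ring.
  apply: (@Rintegral_FTC_oo _ _ (fun y => - (b / 2 * expR x) * expR y +
    - (c * expR x) * (3^-1 * expR (3 * y)))); first exact: ltW.
  - move=> y _; apply: (is_derive1_eq (is_derive1D (is_derive1Z _ (is_derive_expR y))
      (is_derive1Z _ (is_derive1Z _ (is_derive_expM 3 y))))).
    by field.
  - move=> y _; apply: continuousD; apply: continuousM; try exact: cvg_cst.
      exact: continuous_expR.
    exact: continuous_expM.
rewrite mulr0 expR0 (_ : 3 * x = x + x + x); last by ring.
rewrite !expRD expRN /c; field.
exact/lt0r_neq0/expR_gt0.
Qed.

Lemma unstable_lt2 b : b < 2 -> peakon_linearly_unstable b (classY b).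
Proof.
move=> b2; apply: (@unstable_of_eigenfunction _ b (2 - b) expL expL) => //.
- by rewrite subr_gt0.
- apply: (L2norm_neq0 L_expL (ltrN10 R)) => x /andP[_ x0].
  by rewrite expLE// gt_eqF ?expR_gt0.
move=> x; have [_ E] := kernel_integral b x L_expL.
rewrite -[LHS]addrA E => {E}; case: ltgtP => // x0 _.
- rewrite left_Q// expLE// dphi_neg// phi_neg ?ltW//; ring.
- by rewrite kernel_left_pos// expL0 ?ltW//; ring.
Qed.

Let expN x := expL (- x).
Let expNE x : 0 < x -> expN x = expR (- x).
Proof. by move=> x0; rewrite /expN expLE// oppr_lt0. Qed.
Let expN0 x : x <= 0 -> expN x = 0.
Proof. by move=> x0; rewrite /expN expL0// oppr_ge0. Qed.

Let d_expN x : x != 0 -> is_derive x 1 expN (- expN x).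
Proof.
move=> x0; have dN := is_derive1N (is_derive_id x 1).
have Nx0 : - x != 0 by rewrite oppr_eq0.
by apply: (is_derive1_eq (is_derive1_comp (d_expL Nx0) dN)); rewrite mulrN mulr1.
Qed.

Let c_expN x : x != 0 -> {for x, continuous expN}.
Proof. by move=> x0; apply: derivable_continuous; have [] := d_expN x0. Qed.

Let L_expN : L2 expN.
Proof.
apply: (@L2_le _ _ _ 1 L2_phi); first exact: measurable_continuous_neq0.
move=> x; rewrite mul1r (ger0_norm (phi_ge0 x)); have [x0|x0] := ltP 0 x.
  by rewrite expNE// ger0_norm ?expR_ge0// phi_pos// ltW.
by rewrite expN0// normr0 phi_ge0.
Qed.

Let L_expNw : L2 (fun x => (1 - phi x) * - expN x).
Proof.
have mL := L2_measurable L_expN; have mphi := @measurable_phi R.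
apply: (@L2_le _ _ _ 1 L_expN).
  by apply: measurable_funM; [apply: measurable_funB|apply: measurableT_comp].
move=> x; rewrite normrM normrN ler_wpM2r// ger0_norm ?subr_ge0 ?phi_le1//.
by rewrite gerBl phi_ge0.
Qed.

Let right_Q b x : 0 < x -> \int[leb]_y (kernel b x y * expN y) =
  (b - 1) * (expR (- x) - expR (- x) * expR (- x)).
Proof.
move=> x0; rewrite (kernel_right_pos _ _ expN0)//.
have [i3 E3] := @exp_itvoy R 3 x (ltr0Sn _ _).
set c := 3 / 2 * (b - 2).
rewrite [X in _ + X](_ : _ =
    c * (expR (- x) - expR x) * (3^-1 * expR (- 3 * x))); last first.
  rewrite -E3 -RintegralZl//; apply: eq_Rintegral => y.
  rewrite inE/= in_itv/= andbT => xy.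
  by rewrite expNE ?(lt_trans x0)// -mulrA -expRD; congr (_ * expR _); ring.
rewrite [X in X + _](_ : _ =
    (- (b / 2 * expR (- x)) * expR (- x)
      + - (c * expR (- x)) * (3^-1 * expR (- 3 * x))) -
    (- (b / 2 * expR (- x)) * expR (- 0)
      + - (c * expR (- x)) * (3^-1 * expR (- 3 * 0)))); last first.
  transitivity (\int[leb]_(y in `]0, x[)
      (b / 2 * expR (- x) * expR (- y) + c * expR (- x) * expR (- 3 * y))).
    apply: eq_Rintegral => y; rewrite inE/= in_itv/= => /andP[y0 _].
    by rewrite expNE// (_ : - 3 * y = - 2 * y + - y) ?expRD; ring.
  apply: (@Rintegral_FTC_oo _ _ (fun y => - (b / 2 * expR (- x)) * expR (- y) +
    - (c * expR (- x)) * (3^-1 * expR (- 3 * y)))); first exact: ltW.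
  - move=> y _; apply: (is_derive1_eq (is_derive1D
      (is_derive1Z _ (is_derive1_exp (is_derive1N (is_derive_id y 1))))
      (is_derive1Z _ (is_derive1Z _ (is_derive_expM (- 3) y))))).
    by rewrite /=; field.
  - move=> y _; apply: continuousD; apply: continuousM; try exact: cvg_cst.
      by apply: continuous_comp; [exact: continuousN|exact: continuous_expR].
    exact: continuous_expM.
rewrite mulr0 oppr0 expR0 (_ : - 3 * x = - x + - x + - x); last by ring.
rewrite !expRD (_ : expR x = (expR (- x))^-1); last by rewrite expRN invrK.
rewrite /c; field.
exact/lt0r_neq0/expR_gt0.
Qed.

Lemma unstable_gt2 b : 2 < b -> peakon_linearly_unstable b (classY b).
Proof.
move=> b2; apply: (@unstable_of_eigenfunction _ b (b - 2) expN (fun x => - expN x)) => //.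
- by rewrite subr_gt0.
- apply: (L2norm_neq0 L_expN (@ltr01 R)) => x /andP[x0 _].
  by rewrite expNE// gt_eqF ?expR_gt0.
- by move=> x x0; apply: continuousN; exact: c_expN.
move=> x; have [_ E] := kernel_integral b x L_expN.
rewrite -[LHS]addrA E => {E}; case: ltgtP => // x0 _.
- by rewrite kernel_right_neg// expN0 ?ltW//; ring.
- by rewrite right_Q// expNE// dphi_pos// phi_pos ?ltW//; ring.
Qed.

End Exponential_eigenfunctions.

(** * The singular eigenfunction for b = 2 *)

Section Singular_eigenfunction.
Context {R : realType}.
Implicit Types (x y : R).

(* For b = 2 and v supported on x < 0, with k(x) the integral of v over ]x, 0[,
   the eigenvalue equation is lam v = (1 - e^x) v' - e^x k.  In the variable
   y = e^x this is the hypergeometric equation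
   y (1 - y) k'' + (1 - lam - y) k' + k = 0, solved with k = 0 at y = 1 by
   k = y^lam (1 - y)^(1 - lam).  Then v = (y - lam) (y / (1 - y))^lam, which is
   in L^2 for lam < 1/2; with lam = 1/4 the powers are square roots. *)
Let s x := Num.sqrt (1 - expR x).
Let r x := Num.sqrt (s x).
Let m x := expR (4^-1 * x).

Let lt0_exp x : x < 0 -> 0 < 1 - expR x.
Proof. by move=> x0; rewrite subr_gt0 expR_lt1. Qed.

Let s_gt0 x : x < 0 -> 0 < s x.
Proof. by move=> /lt0_exp; rewrite /s sqrtr_gt0. Qed.

Let r_gt0 x : x < 0 -> 0 < r x.
Proof. by move=> /s_gt0; rewrite /r sqrtr_gt0. Qed.

Let s2 x : x < 0 -> s x ^+ 2 = 1 - expR x.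
Proof. by move=> /lt0_exp/ltW; exact: sqr_sqrtr. Qed.

Let r2 x : x < 0 -> r x ^+ 2 = s x.
Proof. by move=> /s_gt0/ltW; exact: sqr_sqrtr. Qed.

(** Substituting this makes the identities below rational in [r x], within reach of [field]. *)
Let r4 x : x < 0 -> expR x = 1 - r x ^+ 4.
Proof. by move=> x0; rewrite -[4%N]/(2 * 2)%N exprM r2// s2// subKr. Qed.

Let d_s x : x < 0 -> is_derive x 1 s (- expR x / (2 * s x)).
Proof.
move=> x0.
have d1 : is_derive x 1 (fun y => 1 - expR y) (- expR x).
  apply: (is_derive1_eq (is_derive1D (is_derive_cst (1 : R) x 1)
    (is_derive1N (is_derive_expR x)))).
  by rewrite add0r.
apply: (@is_derive1_eq _ s _ _ _ (@is_derive1_comp _ Num.sqrt (fun y => 1 - expR y)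
  _ _ _ (is_derive1_sqrt (lt0_exp x0)) d1)).
by rewrite mulrC.
Qed.

Let d_r x : x < 0 -> is_derive x 1 r (- expR x / (4 * r x ^+ 3)).
Proof.
move=> x0; have r0 := lt0r_neq0 (r_gt0 x0); have s0 := lt0r_neq0 (s_gt0 x0).
apply: (@is_derive1_eq _ r _ _ _ (@is_derive1_comp _ Num.sqrt s
  _ _ _ (is_derive1_sqrt (s_gt0 x0)) (d_s x0))).
by rewrite -/(r x) -(r2 x0); field.
Qed.

Let c_s : continuous s.
Proof.
move=> x; apply: continuous_comp; last exact: sqrt_continuous.
by apply: continuousB; [exact: cvg_cst|exact: continuous_expR].
Qed.

Let c_r : continuous r.
Proof. by move=> x; apply: continuous_comp; [exact: c_s|exact: sqrt_continuous]. Qed.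

Let c_m : continuous m. Proof. exact: continuous_expM. Qed.

Let c_Vr x : x < 0 -> {for x, continuous (fun y => (r y)^-1)}.
Proof. by move=> x0; apply: cvgV; [exact/lt0r_neq0/r_gt0|exact: c_r]. Qed.

(** The singular factor (y / (1 - y))^(1/4) of the eigenfunction, y = e^x. It bounds both v and (1 -
    phi) w, so square integrability is proved once. *)
Let u := piecewise (fun y => m y * (r y)^-1) (cst 0).

Let uE x : x < 0 -> u x = m x * (r x)^-1.
Proof. by rewrite /u /piecewise => ->. Qed.

Let u0 x : 0 <= x -> u x = 0.
Proof. by rewrite /u /piecewise ltNge => ->. Qed.

(** A majorant of u^2 = e^(x/2) / s chosen for its elementary primitive, finite at both ends; that
    of u^2 itself is an arcsine. *)
Let h x := expR x * (s x)^-1 + expR (2^-1 * x).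

Let d_h x : x < 0 ->
  is_derive x 1 (fun y => - 2 * s y + 2 * expR (2^-1 * y)) (h x).
Proof.
move=> x0; apply: (is_derive1_eq (is_derive1D (is_derive1Z _ (d_s x0))
  (is_derive1Z _ (is_derive_expM 2^-1 x)))).
by rewrite /h; field; exact/lt0r_neq0/s_gt0.
Qed.

Let c_h x : x < 0 -> {for x, continuous h}.
Proof.
move=> x0; apply: continuousD; last exact: continuous_expM.
apply: continuousM; first exact: continuous_expR.
by apply: cvgV; [exact/lt0r_neq0/s_gt0|exact: c_s].
Qed.

Let i_h : leb.-integrable `]-oo, 0[ (EFin \o h).
Proof.
pose c n : R := - n.+1%:R; pose d n : R := - n.+1%:R^-1.
have d0 : d n @[n --> \oo] --> (0 : R).
  by rewrite -[X in _ --> X]oppr0; apply: cvgN; exact: cvg_harmonic.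
have c0 a : 0 < a -> expR (a * c n) @[n --> \oo] --> (0 : R).
  move=> a0; have := @cvg_expR_affine R a (- 1) a0.
  by rewrite /c; under eq_fun do rewrite -opprD nat1r.
(* The limits at -oo and 0 are left unevaluated, in the shape in which continuity delivers them. *)
apply: (@ge0_integrable_exhaustion _ h (fun y => - 2 * s y + 2 * expR (2^-1 * y)) _ c d
  _ _ _ _ _ _ (- 2 * Num.sqrt (1 - 0) + 2 * 0) (- 2 * s 0 + 2 * expR (2^-1 * 0))) => //.
- move=> n; rewrite lerN2 (le_trans (_ : _ <= 1))//; last by rewrite ler1n.
  by rewrite invf_le1// ler1n.
- move=> n y /=; rewrite !in_itv/= => /andP[_ yd]; apply: le_lt_trans yd _.
  by rewrite oppr_lt0 invr_gt0.
- move=> y /=; rewrite in_itv/= => y0.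
  near=> n; apply/andP; split.
    rewrite lerNl -natr1 ler_wpDr//; near: n; exact: nbhs_infty_ger.
  by near: n; apply: (cvgr_ge (0 : R)) y0.
- apply: cvgD; apply: cvgM; try exact: cvg_cst.
    apply: continuous_cvg; first exact: sqrt_continuous.
    apply: cvgB; first exact: cvg_cst.
    by have := c0 1 ltr01; under eq_fun do rewrite mul1r.
  by apply: c0; rewrite invr_gt0.
- apply: cvgD; apply: cvgM; try exact: cvg_cst.
    by apply: continuous_cvg d0; exact: c_s.
  exact: (continuous_cvg _ (@continuous_expM R 2^-1 0) d0).
- apply: open_continuous_measurable_fun; first exact: interval_open.
  by move=> y; rewrite inE/= in_itv/=; exact: c_h.
- move=> y _; rewrite addr_ge0 ?mulr_ge0 ?expR_ge0//.
  by rewrite invr_ge0 sqrtr_ge0.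
Unshelve. all: by end_near. Qed.

Let u2_le x : x < 0 -> u x ^+ 2 <= h x.
Proof.
move=> x0; rewrite uE// exprMn exprVn r2// /h.
set z := expR (2^-1 * x).
have -> : m x ^+ 2 = z by rewrite expr2 -expRD; congr expR; field.
have ez : expR x = z * z by rewrite -expRD; congr expR; field.
have z0 : 0 < z by exact: expR_gt0.
have z1 : z < 1 by rewrite expR_lt1; lra.
have s0 := s_gt0 x0.
(* With z = e^(x/2) the claim z / s <= z^2 / s + z is equivalent to this, and it holds since (1 -
   z)^2 <= 1 - z^2 = s^2. *)
have zs : 1 - z <= s x.
  rewrite -(@ler_pXn2r _ 2) ?nnegrE//; [|lra|exact: ltW].
  by rewrite s2// ez; nra.
rewrite -(ler_pM2r s0) mulrDl !mulfVK ?gt_eqF// ez; nra.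
Qed.

Let c_u x : x != 0 -> {for x, continuous u}.
Proof.
apply: continuous_piecewise => y y0; last exact: cvg_cst.
by apply: continuousM; [exact: c_m|exact: c_Vr].
Qed.

Let L_u : L2 u.
Proof.
have mu := measurable_continuous_neq0 c_u.
apply/L2P; split=> //; apply: (@integrable_setT_itv _ _ 0).
  apply: (@le_integrable _ _ _ leb _ _ _ (EFin \o (h \_ `]-oo, 0[))) => //.
  - by apply/measurable_EFinP/measurable_funTS; exact: measurable_funX.
  - move=> x /=; rewrite in_itv/= => x0; rewrite lee_fin patchE.
    rewrite (ger0_norm (sqr_ge0 _)) (le_trans _ (ler_norm _))//.
    move: x0; rewrite le_eqVlt => /predU1P[->|x0].
      by rewrite u0// expr0n/=; case: ifP => //; rewrite inE/= in_itv/= ltxx.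
    by rewrite mem_set ?u2_le//= in_itv.
  - rewrite -restrict_EFin; apply/(integrable_restrict _ _ _ _).1 => //.
    by apply: integrableS i_h => //; exact: measurableI.
apply: (eq_integrable _ (cst 0%E)) => //; last exact: integrable0.
move=> x; rewrite inE/= in_itv/= andbT => /ltW/u0 ->.
by rewrite expr0n.
Qed.

Let v := piecewise (fun y => (expR y - 4^-1) * (m y * (r y)^-1)) (cst 0).

Let vE x : x < 0 -> v x = (expR x - 4^-1) * (m x * (r x)^-1).
Proof. by rewrite /v /piecewise => ->. Qed.

Let v0 x : 0 <= x -> v x = 0.
Proof. by rewrite /v /piecewise ltNge => ->. Qed.

Let w := piecewise (fun y => m y * (expR y * (r y)^-1
  + (expR y - 4^-1) * 4^-1 * ((r y)^-1 + expR y * (r y)^-1 ^+ 5))) (cst 0).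

Let wE x : x < 0 -> w x = m x * (expR x * (r x)^-1
  + (expR x - 4^-1) * 4^-1 * ((r x)^-1 + expR x * (r x)^-1 ^+ 5)).
Proof. by rewrite /w /piecewise => ->. Qed.

Let w0 x : 0 <= x -> w x = 0.
Proof. by rewrite /w /piecewise ltNge => ->. Qed.

Let d_vl x : x < 0 ->
  is_derive x 1 (fun y => (expR y - 4^-1) * (m y * (r y)^-1))
    (m x * (expR x * (r x)^-1 + (expR x - 4^-1) * 4^-1 * ((r x)^-1 + expR x * (r x)^-1 ^+ 5))).
Proof.
move=> x0; have r0 := lt0r_neq0 (r_gt0 x0).
apply: (is_derive1_eq (is_derive1M
  (is_derive1D (is_derive_expR x) (is_derive_cst (- 4^-1 : R) x 1))
  (is_derive1M (is_derive_expM 4^-1 x) (is_derive1V r0 (d_r x0))))).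
by rewrite -/(m x) /=; field.
Qed.

Let d_v x : x != 0 -> is_derive x 1 v (w x).
Proof. by apply: is_derive_piecewise => y y0; exact: d_vl. Qed.

Let c_v x : x != 0 -> {for x, continuous v}.
Proof. by move=> x0; apply: derivable_continuous; have [] := d_v x0. Qed.

Let c_w x : x != 0 -> {for x, continuous w}.
Proof.
have cst_c (k z : R) : {for z, continuous (fun _ : R => k)} by exact: cvg_cst.
apply: continuous_piecewise => y y0; last exact: cvg_cst.
have ce := @continuous_expR R y; have cr := c_Vr y0.
apply: continuousM; first exact: c_m.
apply: continuousD; first exact: continuousM.
apply: continuousM; first by apply: continuousM => //; exact: continuousB.
apply: continuousD => //; apply: continuousM => //.
exact: (continuous_comp cr (@exprn_continuous R 5 _)).
Qed.

Let L_v : L2 v.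
Proof.
apply: (@L2_le _ _ _ 1 L_u); first exact: measurable_continuous_neq0.
move=> x; rewrite mul1r; have [x0|x0] := ltP x 0; last by rewrite v0// normr0.
rewrite vE// -uE// normrM ler_piMl// ler_norml.
by have := lt0_exp x0; have := expR_gt0 x; lra.
Qed.

Let L_w : L2 (fun x => (1 - phi x) * w x).
Proof.
apply: (@L2_le _ _ _ 1 L_u).
  apply: measurable_funM; last exact: measurable_continuous_neq0.
  by apply: measurable_funB => //; exact: measurable_phi.
move=> x; rewrite mul1r; have [x0|x0] := ltP x 0; last by rewrite w0// mulr0 normr0.
have r0 := lt0r_neq0 (r_gt0 x0).
(* Here 1 - phi = r^4 lowers the singularity r^-5 of w to the r^-1 of u; what remains is bounded by
   1. *)
have -> : (1 - phi x) * w x = u x *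
    (expR x * (1 - expR x) + (expR x - 4^-1) * 4^-1).
  by rewrite phi_neg ?ltW// wE// uE// r4//; field.
rewrite normrM ler_piMr// ler_norml.
by have := lt0_exp x0; have := expR_gt0 x; nra.
Qed.

(** The function m r^3 is k = y^lam (1 - y)^(1 - lam) at lam = 1/4, and v = - k'. *)
Let d_F x : x < 0 -> is_derive x 1 (fun y => - (m y * r y ^+ 3)) (v x).
Proof.
move=> x0; have r0 := lt0r_neq0 (r_gt0 x0).
apply: (is_derive1_eq (is_derive1N (is_derive1M (is_derive_expM 4^-1 x)
  (is_derive1X 3 (d_r x0))))).
by rewrite -/(m x) vE// r4//=; field.
Qed.

(** On this interval e^(-x) phi y >= 1, so v is dominated by a multiple of phi v, a product of two
    L^2 functions. *)
Let integrable_v x : leb.-integrable `[x, 0[ (EFin \o v).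
Proof.
apply: (@le_integrable _ _ _ leb _ _ _
    (fun y => (expR (- x) * (phi y * v y))%:E)) => //.
- by apply/measurable_EFinP/measurable_funTS; exact: L2_measurable.
- move=> y /=; rewrite in_itv/= => /andP[xy y0].
  rewrite lee_fin !normrM mulrA ler_peMl// ger0_norm ?expR_ge0//.
  rewrite ger0_norm ?phi_ge0// (phi_neg (ltW y0)) -expRD.
  by have := expR_ge1Dx (- x + y); lra.
- apply: (@integrableS _ _ _ leb setT) => //.
  exact: (integrableZl measurableT (expR (- x)) (L2_integrableM L2_phi L_v)).
Qed.

Let int_v x : x < 0 -> \int[leb]_(y in `]x, 0[) v y = m x * r x ^+ 3.
Proof.
move=> x0.
have iv := integrable_v x.
(* With the left end closed, the exhausting intervals can all start at x; only the singular end 0 is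
   approached. *)
have -> : \int[leb]_(y in `]x, 0[) v y = \int[leb]_(y in `[x, 0[) v y.
  apply: Rintegral_itv_obnd_cbnd; apply: integrableS iv => //.
  exact: subset_itv_oo_co.
pose d n : R := x / n.+1%:R.
have d0 : d n @[n --> \oo] --> (0 : R).
  rewrite -[X in _ --> X](mulr0 x); apply: cvgM; first exact: cvg_cst.
  exact: cvg_harmonic.
rewrite -[RHS]opprK -[RHS]sub0r.
have dn n : x <= d n < 0.
  by rewrite /d ler_nMr// nmulr_rlt0// invr_gt0 ltr0n invf_le1 ?ler1n.
apply: (@Rintegral_exhaustion _ v (fun y => - (m y * r y ^+ 3)) `[x, 0[%classic
    (fun=> x) d) => //.
- by move=> n; case/andP: (dn n).
- move=> n y /=; rewrite !in_itv/= => /andP[-> yd].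
  by apply: le_lt_trans yd _; case/andP: (dn n).
- move=> y /=; rewrite in_itv/= => /andP[xy y0].
  by near=> n; rewrite xy; near: n; apply: (cvgr_ge (0 : R)) y0.
- by move=> y; rewrite /= in_itv/= => /andP[_]; exact: d_F.
- by move=> y; rewrite /= in_itv/= => /andP[_ y0]; apply: c_v; rewrite lt_eqF.
- exact: cvg_cst.
- rewrite -[X in _ --> X]oppr0; apply: cvgN.
  have : m 0 * r 0 ^+ 3 = 0 :> R.
    by rewrite /r /s expR0 subrr !sqrtr0 expr0n mulr0.
  move=> <-; apply: cvgM; first exact: (continuous_cvg _ (@c_m 0) d0).
  apply: (continuous_cvg _ (@exprn_continuous R 3 _)).
  exact: (continuous_cvg _ (@c_r 0) d0).
Unshelve. all: by end_near. Qed.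

Let kernel_v x : x < 0 ->
  \int[leb]_y (kernel 2 x y * v y) = - expR x * (m x * r x ^+ 3).
Proof.
move=> x0; rewrite (kernel_left_neg _ _ v0)//.
(* At b = 2 the kernel vanishes for y < x and equals - e^x for x < y < 0. *)
rewrite [X in X + _](_ : _ = 0) ?add0r; last first.
  rewrite subrr !(mulr0, mul0r) (_ : (fun y => _) = cst 0) ?Rintegral_cst ?mul0r//.
  by apply/funext => y; rewrite !mul0r.
rewrite -int_v// -RintegralZl//; last first.
  by apply: integrableS (integrable_v x) => //; exact: subset_itv_oo_co.
by apply: eq_Rintegral => y _; rewrite subrr; field.
Qed.

Lemma unstable_eq2 : peakon_linearly_unstable 2 (classY (2 : R)).
Proof.
apply: (@unstable_of_eigenfunction _ 2 4^-1 v w) => //.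
  (* For x < 0 the only zero of v is at e^x = 1/4, and on ]-1/2, 0[ one has e^x >= 1 + x > 1/2. *)
  apply: (@L2norm_neq0 _ _ (- 2^-1) 0 L_v) => [|x /andP[x1 x0]].
    by rewrite oppr_lt0 invr_gt0.
  rewrite vE// !mulf_neq0 ?invr_neq0 ?gt_eqF ?expR_gt0 ?r_gt0// subr_gt0.
  by have := expR_ge1Dx x; lra.
move=> x; have [_ E] := kernel_integral 2 x L_v.
rewrite -[LHS]addrA E => {E}; case: ltgtP => // x0 _; last first.
  by rewrite kernel_left_pos// v0 ?w0 ?ltW//; ring.
have r0 := lt0r_neq0 (r_gt0 x0).
by rewrite kernel_v// (phi_neg (ltW x0)) wE// vE// r4//; field.
Qed.

End Singular_eigenfunction.

Theorem corollary2p10 (R : realType) (b : R) (hb : b <> 5 / 2) :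
  peakon_linearly_unstable b (classY b).
Proof.
have [b2|b2|->] := ltgtP b 2; first exact: unstable_lt2.
  exact: unstable_gt2.
exact: unstable_eq2.
Qed.
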